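(* Let $m,n,k$ be nonnegative integers with $0\le k\le n$, and let $\lambda^{n,k}=(n,n-1,\ldots,1)+(k,k-1,\ldots,1)$, i.e., the strict partition with $n$ parts whose $i$-th part is $n+k+2-2i$ for $1\le i\le k$ and $n+1-i$ for $k<i\le n$. Then \[ \operatorname{M}(\widetilde{A}(m;\lambda^{n,k};\emptyset))=\frac{1}{2^{n}}\Bigg[\prod_{1\leq i\leq j\leq n}\frac{m+i+j-1}{i+j-1}\prod_{1\leq i\leq j\leq k}\frac{m+i+j}{i+j}\Bigg]^2. \]
   Context: Triangular lattice: lattice points $P(a,b)=a e_1+b e_2$ ($a,b\in\mathbb Z$) with $e_1=(\sqrt3/2,1/2)$, $e_2=(0,1)$. For $a,b\in\mathbb Z$, $R(a,b)$ is the unit triangle with vertices $P(a,b),P(a,b+1),P(a+1,b)$ and $L(a,b)$ the unit triangle with vertices $P(a+1,b),P(a+1,b+1),P(a,b+1)$. A lozenge is the union of two unit triangles sharing an edge; a lozenge tiling of a region is a set of lozenges with disjoint interiors whose union is the region; the weight of a tiling is the product of its lozenges' weights, and $\operatorname{M}(R)$ is the sum of weights of all tilings of $R$. For a strict partition $\lambda=(\lambda_1>\cdots>\lambda_k)$ and $m\ge0$, $\widetilde{A}(m;\lambda;\emptyset)$ is the union of: for each $c\in\{k,\ldots,m+k-1\}$, the triangles $R(a,c),L(a,c)$ with $-\lambda_1\le a\le-1$ and the triangles $R(a,c-a),L(a,c-a-1)$ with $0\le a\le\lambda_1$; for each $i\in[k]$, with $c=k-i$, the triangles $R(a,c)$ with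 $-\lambda_i+1\le a\le-1$, $L(a,c)$ with $-\lambda_i\le a\le -1$, $R(a,c-a),L(a,c-a-1)$ with $0\le a\le \lambda_i-1$, and $R(\lambda_i,c-\lambda_i)$. For each $i\in[k]$ the lozenge $L(\lambda_i-1,k-i-\lambda_i)\cup R(\lambda_i,k-i-\lambda_i)$ has weight $1/2$; all other lozenges have weight $1$; all boundaries are solid. (This is the region obtained by concatenating along a vertical axis $m$ $\wedge$-hooks of order $\lambda_1+1$ and shifted $\wedge$-hooks of orders $\lambda_1,\ldots,\lambda_k$ and removing the forced leftmost strip.) *)

(* Defs.v *)
From HB Require Import structures.
From mathcomp Require Import all_boot all_order all_algebra.
From mathcomp Require Import finmap zify.

Set Implicit Arguments.
Unset Strict Implicit.
Unset Printing Implicit Defensive.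

Import Order.TTheory GRing.Theory Num.Theory.
Local Open Scope ring_scope.

(* The lattice point P(a,b) = a e_1 + b e_2, in the basis (e_1, e_2). *)
Definition point : Type := (int * int)%type.
HB.instance Definition _ := Countable.copy point (int * int)%type.
Definition P (a b : int) : point := (a, b).

(* TriR a b and TriL a b are the unit triangles R(a,b) and L(a,b); every unit
   triangle of the lattice is one of these. *)
Variant triangle : Type := TriR of int & int | TriL of int & int.

Definition triangle_code (t : triangle) : bool * (int * int) :=
  match t with TriR a b => (true, (a, b)) | TriL a b => (false, (a, b)) end.
Definition triangle_decode (x : bool * (int * int)) : triangle :=
  if x.1 then TriR x.2.1 x.2.2 else TriL x.2.1 x.2.2.
Lemma triangle_codeK : cancel triangle_code triangle_decode.
Proof. by case. Qed.
HB.instance Definition _ := Countable.copy triangle (can_type triangle_codeK).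

Definition vertices (t : triangle) : {fset point} :=
  match t with
  | TriR a b => [fset P a b; P a (b + 1); P (a + 1) b]%fset
  | TriL a b => [fset P (a + 1) b; P (a + 1) (b + 1); P a (b + 1)]%fset
  end.

Definition share_edge (t u : triangle) : bool :=
  #|` vertices t `&` vertices u|%fset == 2%N.

(* A finite union of unit triangles is represented by the set of these
   triangles.  Two such unions have disjoint interiors iff the sets of
   triangles are disjoint, and union of regions is union of sets. *)
Definition region : Type := {fset triangle}.

Definition is_lozenge (l : region) : bool :=
  [exists t : l, exists u : l,
     share_edge (val t) (val u) && (l == [fset val t; val u]%fset)].

Definition is_tiling (G : region) (T : {fset region}) : bool :=
  [&& [forall l : T, is_lozenge (val l)], trivIfset T & fcover T == G].

(* A tiling of G consists of subsets of G, so the sum runs over all tilings. *)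
Definition M (w : region -> rat) (G : region) : rat :=
  \sum_(T <- fpowerset (fpowerset G) | is_tiling G T) \prod_(l <- T) w l.

(* The integers a with lo <= a <= hi, see mem_zrange. *)
Definition zrange (lo hi : int) : seq int :=
  [seq a <- [seq lo + i%:Z | i <- iota 0 `|hi - lo|.+1] | a <= hi].

Lemma mem_zrange (lo hi a : int) : (a \in zrange lo hi) = (lo <= a <= hi).
Proof.
rewrite mem_filter andbC; have [le_a|] := boolP (a <= hi); last by rewrite !andbF.
rewrite !andbT; apply/mapP/idP => [[i _ ->]|le_lo]; first by lia.
by exists `|a - lo|%N; [rewrite mem_iota; lia | lia].
Qed.

Definition is_strict_partition (lam : seq nat) : bool :=
  sorted gtn lam && all (fun p => 0 < p)%N lam.

(* lambda_i, with i >= 1; in particular lambda_1 = 0 for the empty partition. *)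
Definition part (lam : seq nat) (i : nat) : nat := nth 0%N lam i.-1.

(* For r = lambda_1: the triangles of level c in a wedge-hook of order r + 1. *)
Definition hook (r : nat) (c : int) : seq triangle :=
  [seq TriR a c | a <- zrange (- r%:Z) (- 1)] ++
  [seq TriL a c | a <- zrange (- r%:Z) (- 1)] ++
  [seq TriR a (c - a) | a <- zrange 0 r%:Z] ++
  [seq TriL a (c - a - 1) | a <- zrange 0 r%:Z].

(* For r = lambda_i: the triangles of level c in a shifted wedge-hook of
   order r, without its forced leftmost part. *)
Definition shifted_hook (r : nat) (c : int) : seq triangle :=
  [seq TriR a c | a <- zrange (- r%:Z + 1) (- 1)] ++
  [seq TriL a c | a <- zrange (- r%:Z) (- 1)] ++
  [seq TriR a (c - a) | a <- zrange 0 (r%:Z - 1)] ++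
  [seq TriL a (c - a - 1) | a <- zrange 0 (r%:Z - 1)] ++
  [:: TriR r%:Z (c - r%:Z)].

(* The region A~(m; lam; empty). *)
Definition regionA (m : nat) (lam : seq nat) : region :=
  let k := size lam in
  [fset t in
     flatten [seq hook (part lam 1) c%:Z | c <- index_iota k (m + k)] ++
     flatten [seq shifted_hook (part lam i) (k%:Z - i%:Z)
             | i <- index_iota 1 k.+1]]%fset.

Definition special_lozenge (lam : seq nat) (i : nat) : region :=
  let p := (part lam i)%:Z in
  let b := (size lam)%:Z - i%:Z - p in
  [fset TriL (p - 1) b; TriR p b]%fset.

Definition weightA (lam : seq nat) (l : region) : rat :=
  if has (fun i => l == special_lozenge lam i) (index_iota 1 (size lam).+1)
  then 1 / 2 else 1.

(* (n, n-1, ..., 1) + (k, k-1, ..., 1), the second summand being padded with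
   zeros by the truncated subtraction. *)
Definition lam_nk (n k : nat) : seq nat :=
  [seq ((n + 1 - i) + (k + 1 - i))%N | i <- index_iota 1 n.+1].

Lemma size_lam_nk n k : size (lam_nk n k) = n.
Proof. by rewrite size_map size_iota subn1. Qed.

Lemma part_lam_nk n k i : (k <= n)%N -> (1 <= i <= n)%N ->
  part (lam_nk n k) i = if (i <= k)%N then (n + k + 2 - 2 * i)%N
                        else (n + 1 - i)%N.
Proof.
move=> le_kn i_rng; rewrite /part /lam_nk.
rewrite (nth_map 0%N) ?size_iota ?nth_iota //; try lia.
case: ifP; lia.
Qed.

Lemma lam_nk_strict n k : is_strict_partition (lam_nk n k).
Proof.
apply/andP; split; last first.
  by apply/allP => p /mapP[i]; rewrite mem_index_iota => ? ->; lia.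
apply/(sortedP 0%N) => i; rewrite size_lam_nk => lt_i.
by rewrite /= !(nth_map 0%N) ?size_iota ?nth_iota //=; lia.
Qed.

(* Main.v *)
Require Import Defs.
From mathcomp Require Import all_boot all_order all_algebra.
From mathcomp Require Import perm finmap zify ring lra.

(** Reading a tiling from left to right, the lozenges whose two triangles do not
    share a vertical edge form [m] non-intersecting paths, so the weighted count is
    [2 ^- n] times an [m x m] determinant [\det (L *m B)], where [L] counts the
    paths left of the symmetry axis and [B] those right of it (a path through a
    special triangle being counted twice).  The functions
    [f_i s = 'C(s + l_i - 1 - i, l_i - 1)], with [l_0 < l_1 < ...] the parts of
    the partition, span up to signs the orthogonal complement of the rows of
    [L], and [g_i s = f_i s + 2 * \sum_(t < s) f_i t] that of the columns of
    [B]; hence the determinant is also that of the [n x n] Gram matrix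
    [\sum_(s, t) f_i t * (1 + sgn (s - t)) * f_j s].

    For [lam_nk n k] the [f_i] span the polynomials [x ^+ e] in a centred
    variable [x], with [e] in [0, ..., r - 1, r + 1, r + 3, ..., r + 2 k - 1] and
    [r = n - k].  When the centre [c] of the [n + m] summation points moves, the
    Gram determinant is a polynomial in [c] of degree at most [k (k + 1)], whose
    top coefficient depends on [k] only through a factor independent of [m].
    Its form is a skew form plus a square, and at [c = t / 2] all but [t] of the
    points are symmetric about the origin, so parity bounds the rank; this gives
    all the roots.  The remaining constant follows by induction on [m] from the
    case [k = n], in which all the functions are odd and vanish at the origin. *)

Set Implicit Arguments.
Unset Strict Implicit.
Unset Printing Implicit Defensive.
Import Order.TTheory GRing.Theory Num.Theory.
Local Open Scope ring_scope.

(** * Tilings and expansion at a triangle *)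

Section Tilings.
Local Open Scope fset_scope.

Lemma cardfsI3 (T : choiceType) (x y z : T) (B : {fset T}) :
  uniq [:: x; y; z] ->
  #|` [fset x; y; z] `&` B| = ((x \in B) + (y \in B) + (z \in B))%N.
Proof.
rewrite /= !inE !negb_or => /and3P[/andP[xy xz] yz _].
have cardI1 (u : T) (A : {fset T}) : u \notin A ->
    #|` (u |` A) `&` B| = ((u \in B) + #|` A `&` B|)%N.
  move=> uA; rewrite fsetIUl [LHS]cardfsU.
  have -> : ([fset u] `&` B) `&` (A `&` B) = fset0.
    apply/fsetP => v; rewrite !inE.
    by case: eqP => //= ->; rewrite (negbTE uA) !andbF.
  rewrite cardfs0 subn0; congr (_ + _)%N; case: (boolP (u \in B)) => uB.
    have -> : [fset u] `&` B = [fset u].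
      by apply/fsetP => v; rewrite !inE; case: eqP => // ->.
    by rewrite cardfs1.
  have -> : [fset u] `&` B = fset0.
    by apply/fsetP => v; rewrite !inE; case: eqP => //= ->; apply/negbTE.
  by rewrite cardfs0.
have -> : [fset x; y; z] = x |` (y |` (z |` fset0)).
  by apply/fsetP => v; rewrite !inE orbF orbA.
rewrite !cardI1 ?inE ?orbF //; last by rewrite negb_or xy xz.
by rewrite fset0I cardfs0 addn0 addnA.
Qed.

Definition neighbours (t : triangle) : seq triangle :=
  match t with
  | TriR a b => [:: TriL a b; TriL a (b - 1); TriL (a - 1) b]
  | TriL a b => [:: TriR a b; TriR a (b + 1); TriR (a + 1) b]
  end.

Lemma triR_eq a b c d : (TriR a b == TriR c d) = (a == c) && (b == d).
Proof. by apply/eqP/andP => [[-> ->]//|[/eqP-> /eqP->]]. Qed.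

Lemma triL_eq a b c d : (TriL a b == TriL c d) = (a == c) && (b == d).
Proof. by apply/eqP/andP => [[-> ->]//|[/eqP-> /eqP->]]. Qed.

Lemma triRL_eq a b c d : (TriR a b == TriL c d) = false.
Proof. by apply/eqP. Qed.

Lemma triLR_eq a b c d : (TriL a b == TriR c d) = false.
Proof. by apply/eqP. Qed.

Definition tri_eqE := (triR_eq, triL_eq, triRL_eq, triLR_eq).

Lemma point_eq (a b c d : int) : (P a b == P c d) = (a == c) && (b == d).
Proof. by []. Qed.

Lemma share_edgeE t u : share_edge t u = (u \in neighbours t).
Proof.
have eqS (x y : int) : ((x + 1)%R == (y + 1)%R) = (x == y) by apply/eqP/eqP; lia.
have eqP1 (x y : int) : (y == x - 1)%R = (x == (y + 1)%R) by apply/eqP/eqP; lia.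
have nS (x : int) : (x == (x + 1)%R) = false by apply/eqP; lia.
have nS' (x : int) : ((x + 1)%R == x) = false by apply/eqP; lia.
(* At most one of the three coordinate relations can hold, so the claim reduces to finitely many
   booleans. *)
have excl (x y : int) : [|| (x == y) && (x == (y + 1)%R), (x == y) && ((x + 1)%R == y)
    | (x == (y + 1)%R) && ((x + 1)%R == y)] = false.
  by apply/negP => /or3P[]/andP[/eqP ? /eqP ?]; lia.
rewrite /share_edge; case: t => a b; case: u => c d; rewrite /vertices /neighbours.
all: rewrite cardfsI3; last by rewrite /uniq !inE !point_eq !(nS, nS') !andbF.
all: rewrite ?inE ?point_eq ?tri_eqE ?eqP1 ?eqS.
all: rewrite ?[c == a]eq_sym ?[d == b]eq_sym ?[c == (a + 1)%R]eq_sym ?[d == (b + 1)%R]eq_sym.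
all: move: (excl a c) (excl b d); move: (a == c) (a == (c + 1)%R) ((a + 1)%R == c).
all: move: (b == d) (b == (d + 1)%R) ((b + 1)%R == d).
all: by do 6!case.
Qed.

Lemma share_edge_sym t u : share_edge t u = share_edge u t.
Proof. by rewrite /share_edge fsetIC. Qed.

Lemma is_lozengeP (l : region) :
  reflect (exists t u, share_edge t u /\ l = [fset t; u]) (is_lozenge l).
Proof.
apply: (iffP existsP) => [[t /existsP[u /andP[tu /eqP ->]]]|[t [u [tu ->]]]].
  by exists (val t), (val u).
have tin : t \in [fset t; u] by rewrite !inE eqxx.
have uin : u \in [fset t; u] by rewrite !inE eqxx orbT.
by exists [` tin]; apply/existsP; exists [` uin]; rewrite /= tu eqxx.
Qed.

Lemma fset2_inj (T : choiceType) (t u v : T) : [fset t; u] = [fset t; v] -> u = v.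
Proof.
move=> /fsetP h; have := h u; rewrite !inE eqxx orbT => /esym/orP[/eqP ut|/eqP//].
by have := h v; rewrite !inE eqxx orbT ut orbb => /eqP.
Qed.

Lemma is_tilingP (G : region) (T : {fset region}) :
  reflect [/\ forall l, l \in T -> is_lozenge l,
              forall l l' t, l \in T -> l' \in T -> t \in l -> t \in l' -> l = l' &
              forall t, t \in G <-> exists2 l, l \in T & t \in l]
          (is_tiling G T).
Proof.
apply: (iffP and3P) => [[/forallP loz /trivIfsetP tri /eqP cov]|[loz tri cov]].
  split=> [l lT|l l' t lT l'T tl tl'|t].
  - exact: (loz [` lT]).
  - apply/eqP; apply/negPn/negP => /(tri _ _ lT l'T)/fdisjointP/(_ t tl).
    by rewrite tl'.
  - rewrite -cov; split=> [/bigfcupP[l /andP[lT _] tl]|[l lT tl]]; first by exists l.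
    by apply/bigfcupP; exists l => //; rewrite lT.
split.
- by apply/forallP => l; apply/loz/valP.
- apply/trivIfsetP => l l' lT l'T ll'; apply/fdisjointP => t tl.
  by apply/negP => tl'; move/eqP: ll'; apply; apply: tri tl tl'.
- apply/eqP/fsetP => t; apply/bigfcupP/idP => [[l /andP[lT _] tl]|/cov[l lT tl]].
    by apply/cov; exists l.
  by exists l => //; rewrite lT.
Qed.

Lemma M0 w : M w fset0 = 1.
Proof.
rewrite /M fpowerset0 fpowerset1 big_fset_condE /=.
have -> : [fset T in [fset fset0; [fset fset0]] | is_tiling fset0 T]
          = [fset (fset0 : {fset region})].
  apply/fsetP => T; rewrite !inE; apply/andP/eqP => [[/orP[/eqP->//|/eqP->]]|->].
    case/is_tilingP => /(_ fset0); rewrite inE eqxx => /(_ isT).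
    by move=> /is_lozengeP[t [u [_ /fsetP/(_ t)]]]; rewrite !inE eqxx.
  rewrite eqxx; split=> //; apply/is_tilingP; split=> [l|l l' t|t]; rewrite ?inE //.
  by split=> // -[l]; rewrite inE.
by rewrite big_seq_fset1 big_seq_fset0.
Qed.

Lemma tiling_sub (G : region) T l : is_tiling G T -> l \in T -> l `<=` G.
Proof.
by move=> /is_tilingP[_ _ cov] lT; apply/fsubsetP => t tl; apply/cov; exists l.
Qed.

Lemma tiling_powerset (G : region) T :
  is_tiling G T -> T \in fpowerset (fpowerset G).
Proof.
move=> til; rewrite fpowersetE; apply/fsubsetP => l lT.
by rewrite fpowersetE; apply: tiling_sub til lT.
Qed.

Lemma tilingU1 (G : region) t u T :
  t \in G -> u \in G -> share_edge t u ->
  is_tiling (G `\` [fset t; u]) T ->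
  ([fset t; u] \notin T) && is_tiling G ([fset t; u] |` T).
Proof.
move=> tG uG tu til; have [loz tri cov] := is_tilingP _ _ til.
have dis l v : l \in T -> v \in l -> v \in [fset t; u] = false.
  move=> lT vl; have : v \in G `\` [fset t; u] by apply/cov; exists l.
  by rewrite in_fsetD => /andP[/negbTE].
apply/andP; split.
  by apply/negP => tuT; have := dis _ t tuT; rewrite !inE eqxx => /(_ isT).
apply/is_tilingP; split=> [l|l l' v|v].
- by rewrite !inE => /orP[/eqP->|/loz//]; apply/is_lozengeP; exists t, u.
- rewrite !in_fset1U => /orP[/eqP->|lT] /orP[/eqP->|l'T] // vl vl'.
  + by rewrite (dis _ _ l'T vl') in vl.
  + by rewrite (dis _ _ lT vl) in vl'.
  + exact: tri vl vl'.
- split=> [vG|[l]].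
    case: (boolP (v \in [fset t; u])) => vtu.
      by exists [fset t; u] => //; rewrite !inE eqxx.
    have /cov[l lT vl] : v \in G `\` [fset t; u] by rewrite in_fsetD vtu vG.
    by exists l => //; rewrite !inE lT orbT.
  rewrite in_fset1U => /orP[/eqP->|lT vl].
    by rewrite !inE => /orP[]/eqP->.
  have : v \in G `\` [fset t; u] by apply/cov; exists l.
  by rewrite in_fsetD => /andP[].
Qed.

Lemma tilingD1 (G : region) t u T :
  is_tiling G T -> [fset t; u] \in T ->
  is_tiling (G `\` [fset t; u]) (T `\ [fset t; u]).
Proof.
move=> /is_tilingP[loz tri cov] tuT; apply/is_tilingP; split=> [l|l l' v|v].
- by rewrite in_fsetD1 => /andP[_ /loz].
- by rewrite !in_fsetD1 => /andP[_ lT] /andP[_ l'T]; apply: tri.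
- rewrite in_fsetD; split=> [/andP[vtu /cov[l lT vl]]|[l]].
    exists l => //; rewrite in_fsetD1 lT andbT.
    by apply: contraNneq vtu => <-.
  rewrite in_fsetD1 => /andP[ltu lT] vl; apply/andP; split; last by apply/cov; exists l.
  by apply: contraNN ltu => vtu; apply/eqP; apply: tri vl vtu.
Qed.

(** Every tiling covers [t] by exactly one lozenge, and deleting it is a bijection onto the tilings
    of the remaining region. *)
Lemma M_expand w (G : region) t : t \in G ->
  M w G = \sum_(u <- G | share_edge t u) w [fset t; u] * M w (G `\` [fset t; u]).
Proof.
move=> tG; rewrite {1}/M.
(* The inner sum has a single nonzero term, that of the partner of [t] in [T]; this allows the two
   sums to be exchanged. *)
transitivity (\sum_(T <- fpowerset (fpowerset G) | is_tiling G T)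
   \sum_(u <- G | share_edge t u) if [fset t; u] \in T then \prod_(l <- T) w l else 0).
  apply: eq_bigr => T til; have [loz tri cov] := is_tilingP _ _ til.
  have /cov[l lT tl] := tG.
  have [u tu lE] : exists2 u, share_edge t u & l = [fset t; u].
    have /is_lozengeP[a [b [ab lE]]] := loz _ lT.
    move: tl; rewrite lE !inE => /orP[]/eqP->; first by exists b.
    by exists a; rewrite 1?share_edge_sym // fsetUC.
  have uG : u \in G by apply/cov; exists l; rewrite // lE !inE eqxx orbT.
  rewrite [RHS]big_mkcond [RHS](big_fsetD1 u) //= tu -lE lT.
  rewrite [X in (_ + X)%R]big_seq [X in (_ + X)%R]big1 ?addr0 // => v.
  rewrite in_fsetD1 => /andP[vu _]; case: ifP => // tv; case: ifP => // tvT.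
  case/eqP: vu; apply: (@fset2_inj _ t); rewrite -lE.
  by apply: (tri _ _ t) => //; rewrite !inE eqxx.
rewrite exchange_big /= [LHS]big_seq_cond [RHS]big_seq_cond; apply: eq_bigr => u /andP[uG tu].
rewrite -big_mkcondr /= /M big_distrr /=.
pose S := [fset T in fpowerset (fpowerset (G `\` [fset t; u]))
              | is_tiling (G `\` [fset t; u]) T].
have injS : {in S &, injective (fun T : {fset region} => [fset t; u] |` T)}.
  move=> T T'; rewrite !inE => /andP[_ tT] /andP[_ tT'] TT'.
  have /andP[nT _] := tilingU1 tG uG tu tT.
  have /andP[nT' _] := tilingU1 tG uG tu tT'.
  by rewrite -(fsetU1K nT) TT' fsetU1K.
rewrite big_fset_condE [in RHS]big_fset_condE -/S.
transitivity (\sum_(T <- [fset ([fset t; u] |` T) | T in S]) \prod_(l <- T) w l).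
  apply: eq_fbig => // T; rewrite !inE /=; apply/andP/imfsetP => [[_ /andP[til tuT]]|].
    exists (T `\ [fset t; u]); last by rewrite /= fsetD1K.
    have til' := tilingD1 til tuT.
    by rewrite !inE til' (tiling_powerset til').
  case=> T' /=; rewrite !inE => /andP[_ til'] ->.
  have /andP[_ til] := tilingU1 tG uG tu til'.
  by rewrite til (tiling_powerset til) !inE eqxx.
rewrite big_imfset //= big_seq [in RHS]big_seq; apply: eq_bigr => T.
rewrite !inE => /andP[_ til]; have /andP[nT _] := tilingU1 tG uG tu til.
by rewrite big_fsetU1.
Qed.

End Tilings.

(** * From tilings to path determinants *)

Lemma M_expand_neighbours w (G : region) t : t \in G ->
  M w G = \sum_(u <- neighbours t | u \in G)
            w [fset t; u]%fset * M w (G `\` [fset t; u])%fset.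
Proof.
move=> tG; rewrite (M_expand w tG) -[LHS]big_filter -[RHS]big_filter.
apply: perm_big; apply: uniq_perm; rewrite ?filter_uniq ?fset_uniq //.
  by case: (t) => a b /=; rewrite !inE !tri_eqE; apply/and3P; split=> //; lia.
by move=> u; rewrite !mem_filter share_edgeE andbC.
Qed.

Section RowDeterminant.
Variables (R : comNzRingType) (m : nat).

(** Rows are kept in a list so that they can be treated one at a time, from the bottom triangle
    up. *)
Definition rowdet (s : seq 'rV[R]_m) : R := \det (\matrix_(i < m) nth 0 s i).

Lemma rowdet_linear (s1 s2 : seq 'rV[R]_m) (a b : R) (u v : 'rV[R]_m) :
  (size s1 < m)%N ->
  rowdet (s1 ++ (a *: u + b *: v) :: s2) =
  a * rowdet (s1 ++ u :: s2) + b * rowdet (s1 ++ v :: s2).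
Proof.
move=> lt_s1; pose i0 := Ordinal lt_s1.
have nthi x : nth 0 (s1 ++ x :: s2) i0 = x by rewrite nth_cat ltnn subnn.
apply: (determinant_multilinear (i0 := i0)).
- by rewrite !rowK !nthi.
all: apply/matrixP => i j; rewrite !mxE !nth_cat /= /bump.
all: case: (leqP (size s1) i) => lt_i; rewrite ?add0n ?add1n; last by rewrite lt_i.
all: by rewrite ltnNge leqW //= subSn.
Qed.

Lemma rowdet_dup (s1 s2 : seq 'rV[R]_m) (u : 'rV[R]_m) :
  (size s1 < m)%N -> u \in s1 -> rowdet (s1 ++ u :: s2) = 0.
Proof.
move=> lt_s1 us1; have lt_i : (index u s1 < size s1)%N by rewrite index_mem.
apply: (determinant_alternate (i1 := Ordinal (ltn_trans lt_i lt_s1))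
                              (i2 := Ordinal lt_s1)).
  by rewrite -val_eqE /= neq_ltn lt_i.
by move=> j; rewrite !mxE /= !nth_cat lt_i ltnn subnn nth_index.
Qed.

Lemma rowdet_scale (s : seq int) (c : int -> R) (r : int -> 'rV[R]_m) :
  size s = m ->
  rowdet [seq c b *: r b | b <- s] = (\prod_(b <- s) c b) * rowdet [seq r b | b <- s].
Proof.
move=> size_s; rewrite (big_nth 0) size_s big_mkord.
have -> : \prod_(i < m) c (nth 0 s i) = \det (diag_mx (\row_(i < m) c (nth 0 s i))).
  by rewrite det_diag; apply: eq_bigr => i _; rewrite mxE.
rewrite -det_mulmx mul_diag_mx; congr (\det _); apply/matrixP => i j.
by rewrite !mxE !(nth_map 0) ?size_s // !mxE.
Qed.

End RowDeterminant.

(** * Transfer across one column of triangles *)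

Section Strips.
Local Open Scope fset_scope.

Definition Rcol (x : int) (s : seq int) : seq triangle := [seq TriR x b | b <- s].
Definition Lcol (x : int) (s : seq int) : seq triangle := [seq TriL x b | b <- s].

Lemma mem_Rcol x s t :
  (t \in Rcol x s) = if t is TriR a b then (a == x) && (b \in s) else false.
Proof.
apply/mapP/idP => [[b bs ->]|]; first by rewrite eqxx.
by case: t => // a b /andP[/eqP-> bs]; exists b.
Qed.

Lemma mem_Lcol x s t :
  (t \in Lcol x s) = if t is TriL a b then (a == x) && (b \in s) else false.
Proof.
apply/mapP/idP => [[b bs ->]|]; first by rewrite eqxx.
by case: t => // a b /andP[/eqP-> bs]; exists b.
Qed.

Lemma mem_fsetU_seq (Z : region) (s : seq triangle) t :
  (t \in Z `|` [fset u in s]) = (t \in Z) || (t \in s).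
Proof. by rewrite !inE. Qed.

Lemma mem_fset_seq (s : seq triangle) t : (t \in [fset u in s]) = (t \in s).
Proof. by rewrite inE. Qed.

Section OneStrip.
Variables (w : region -> rat) (x : int) (Z : region).

(* [C] lists the heights of the left-pointing triangles already used and [O]
   those of the right-pointing ones still to be matched, from the bottom up.
   Then [C ++ O] stays sorted, so no sign appears, and choosing a used triangle
   corresponds to repeating a row of the determinant. *)
Lemma match_strip m (r : int -> 'rV[rat]_m) (P : seq int) (kappa : rat) :
  (forall b, TriR x b \notin Z) -> (forall b, TriL x b \notin Z) ->
  (forall b, TriL (x - 1)%R b \notin Z) ->
  (forall b, w [fset TriR x b; TriL x b] = 1) ->
  (forall b, w [fset TriR x b; TriL x (b - 1)%R] = 1) ->
  (forall C, pairwise <%R C -> {subset C <= P} -> size C = m ->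
     M w (Z `|` [fset t in Lcol x [seq b <- P | b \notin C]])
     = kappa * rowdet [seq r b | b <- C]) ->
  forall O C, pairwise <%R (C ++ O) -> {subset C <= P} -> (size C + size O)%N = m ->
    M w (Z `|` [fset t in Rcol x O ++ Lcol x [seq b <- P | b \notin C]]) =
    kappa * rowdet ([seq r b | b <- C] ++
       [seq (\sum_(b' <- [:: b - 1; b] | b' \in P) r b')%R | b <- O]).
Proof.
have lt_pred (y b : int) : (y < b -> y != b - 1 -> y < b - 1)%R by lia.
have le_pred (b : int) : (b - 1 <= b)%R by lia.
move=> ZR ZL ZL' w0 w1 H; elim=> [|b O IH] C.
  by rewrite !cats0 addn0 => *; apply: H.
move=> pw CP szm; set G := _ `|` _.
have tG : TriR x b \in G by rewrite mem_fsetU_seq mem_cat mem_Rcol eqxx inE eqxx orbT.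
have [pwC /andP[bO pwO] Cb CO] :
  [/\ pairwise <%R C, all (fun y => b < y)%R O && pairwise <%R O,
      {in C, forall y, y < b}%R & allrel <%R C O].
  move: pw; rewrite pairwise_cat pairwise_cons allrel_consr => /and3P[/andP[aC aCO] pC pO].
  by split=> //; apply/allP.
have bnO : b \notin O by apply/negP => /(allP bO); rewrite ltxx.
have bnC : b \notin C by apply/negP => /Cb; rewrite ltxx.
have szC : (size [seq r b | b <- C] < m)%N by rewrite size_map -szm /= addnS ltnS leq_addr.
(* Matching [TriR x b] with [TriL x b'] appends [b'] to [C]; the concatenation stays sorted because
   [b' <= b]. *)
have step b' : b' \in P -> b' \notin C -> {in C, forall y, y < b'}%R ->
    (b' <= b)%R -> 
    M w (G `\` [fset TriR x b; TriL x b']) =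
    kappa * rowdet ([seq r b | b <- C] ++ r b' ::
       [seq (\sum_(b' <- [:: b - 1; b] | b' \in P) r b')%R | b <- O]).
  move=> b'P b'C Cb' le_b'.
  have -> : G `\` [fset TriR x b; TriL x b'] =
      Z `|` [fset t in Rcol x O ++ Lcol x [seq b <- P | b \notin rcons C b']].
    apply/fsetP => t; rewrite in_fsetD in_fset2 !mem_fsetU_seq !mem_cat !mem_Rcol !mem_Lcol.
    case: t => a c; rewrite !tri_eqE ?mem_filter ?inE ?orbF ?orFb.
      have [/= ->|//] := eqVneq a x; rewrite (negbTE (ZR _)) /=.
      by have [->|//] := eqVneq c b; rewrite (negbTE bnO).
    have [/= ->|//] := eqVneq a x; rewrite (negbTE (ZL _)) /= mem_rcons inE.
    by rewrite negb_or; case: (c == b').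
  rewrite IH ?map_rcons ?cat_rcons //.
  - rewrite pairwise_cat pwC /= pwO allrel_consr CO /= !andbT.
    apply/andP; split; first exact/allP.
    by apply/allP => y /(allP bO); apply: le_lt_trans.
  - by move=> y; rewrite mem_rcons inE => /orP[/eqP->|/CP].
  - by rewrite size_rcons -szm addSn addnS.
have nG : TriL (x - 1)%R b \in G = false.
  rewrite mem_fsetU_seq mem_cat mem_Rcol mem_Lcol (negbTE (ZL' _)) /=.
  by have -> : (x - 1 == x)%R = false by lia.
have inG c : TriL x c \in G = (c \in P) && (c \notin C).
  by rewrite mem_fsetU_seq mem_cat mem_Rcol mem_Lcol (negbTE (ZL _)) eqxx mem_filter [RHS]andbC.
(* The neighbour across the vertical edge is absent, and [TriL x b] cannot have been used since all
   of [C] lies below [b]. Only [TriL x (b - 1)] may already be taken. *)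
have -> : M w G = ((if b \in P then M w (G `\` [fset TriR x b; TriL x b]) else 0) +
      (if (b - 1 \in P)%R && (b - 1 \notin C)%R then
                 M w (G `\` [fset TriR x b; TriL x (b - 1)%R]) else 0))%R.
  rewrite (M_expand_neighbours _ tG) /= !big_cons big_nil nG !inG bnC andbT w0 w1.
  by rewrite !mul1r addr0; case: ifP; rewrite ?add0r.
have split_row : (\sum_(b' <- [:: b - 1; b]%R | b' \in P) r b' =
   (b - 1 \in P)%R%:R *: r (b - 1) + (b \in P)%:R *: r b)%R.
  rewrite !big_cons big_nil.
  by case: ifP => _; case: ifP => _; rewrite ?scale1r ?scale0r ?addr0 ?add0r.
rewrite map_cons split_row rowdet_linear // {split_row}.
rewrite addrC mulrDr; congr (_ + _)%R.
  case: (boolP (b - 1 \in P)%R) => [bP|_] /=; last by rewrite mul0r mulr0.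
  (* If [b - 1] is already taken, the row is repeated, so including this forbidden choice in the
     determinant adds 0. *)
  rewrite mul1r; case: (boolP (b - 1 \in C)%R) => [bC|bC] /=.
    by rewrite rowdet_dup ?mulr0 // map_f.
  rewrite step // => y yC; apply: lt_pred; first exact: Cb.
  by apply: contraNneq bC => <-.
case: (boolP (b \in P)%R) => [bP|_] /=; last by rewrite mul0r mulr0.
by rewrite mul1r step.
Qed.

(** Column [x] has no right-pointing triangle left, so each [TriL x b] is forced to pair with
    [TriR (x + 1) b]. *)
Lemma match_horizontal (Q D : seq int) :
  (forall b, TriR x b \notin Z) -> (forall b, TriL x b \notin Z) ->
  (forall b, TriR (x + 1)%R b \notin Z) ->
  uniq Q -> {subset Q <= D} ->
  M w (Z `|` [fset t in Lcol x Q ++ Rcol (x + 1)%R D]) =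
  (\prod_(b <- Q) w [fset TriL x b; TriR (x + 1)%R b])%R *
  M w (Z `|` [fset t in Rcol (x + 1)%R [seq b <- D | b \notin Q]]).
Proof.
move=> ZR ZL ZR'; elim: Q D => [|b Q IH] D.
  by move=> _ _; rewrite big_nil mul1r filter_predT.
move=> /andP[bQ uQ] QD; set G := _ `|` _.
have tG : TriL x b \in G by rewrite mem_fsetU_seq mem_cat mem_Lcol eqxx inE eqxx orbT.
rewrite (M_expand_neighbours _ tG) /= !big_cons big_nil.
have notG c : TriR x c \in G = false.
  rewrite mem_fsetU_seq mem_cat mem_Rcol mem_Lcol (negbTE (ZR _)) /=.
  by have -> : (x == x + 1)%R = false by lia.
have -> : TriR (x + 1)%R b \in G.
  by rewrite mem_fsetU_seq mem_cat mem_Rcol mem_Lcol eqxx QD ?inE ?eqxx ?orbT.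
rewrite !notG addr0 -mulrA; congr (_ * _)%R.
have -> : G `\` [fset TriL x b; TriR (x + 1)%R b] =
  Z `|` [fset t in Lcol x Q ++ Rcol (x + 1)%R [seq c <- D | c != b]].
  apply/fsetP => t; rewrite in_fsetD in_fset2 !mem_fsetU_seq !mem_cat !mem_Rcol !mem_Lcol.
  case: t => a c; rewrite !tri_eqE ?mem_filter ?inE ?orbF ?orFb.
    have [/= ->|//] := eqVneq a (x + 1)%R; rewrite (negbTE (ZR' _)) /=.
    by case: (c == b).
  have [/= ->|//] := eqVneq a x; rewrite (negbTE (ZL _)) /=.
  by have [->|//] := eqVneq c b; rewrite (negbTE bQ).
rewrite IH //; last first.
  move=> c cQ; rewrite mem_filter QD ?inE ?cQ ?orbT // andbT.
  by apply: contraNneq bQ => <-.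
congr (_ * M _ (_ `|` [fset t in Rcol _ _]))%R.
by rewrite -filter_predI; apply: eq_filter => c; rewrite /= inE negb_or andbC.
Qed.

End OneStrip.

End Strips.

Section Stack.
Local Open Scope fset_scope.

(* [stack x s Ps] has the right-pointing triangles of column [x] at the heights
   [s]; [Ps] lists the heights of the vertical edges on the lines
   [x + 1, x + 2, ...], the last line being the right boundary. *)
Fixpoint stack (x : int) (s : seq int) (Ps : seq (seq int)) : seq triangle :=
  if Ps is P :: Ps' then Rcol x s ++ Lcol x P ++ stack (x + 1)%R P Ps' else [::].

Lemma stackR x s Ps a b : TriR a b \in stack x s Ps -> (x <= a)%R.
Proof.
elim: Ps x s => [|P Ps IH] x s //=.
rewrite !mem_cat mem_Rcol mem_Lcol /= => /orP[/andP[/eqP-> _]//|/IH].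
by apply: le_trans; rewrite lerDl.
Qed.

Lemma stackL x s Ps a b : TriL a b \in stack x s Ps -> (x <= a)%R.
Proof.
elim: Ps x s => [|P Ps IH] x s //=.
rewrite !mem_cat mem_Rcol mem_Lcol /= => /orP[/andP[/eqP-> _]//|/IH].
by apply: le_trans; rewrite lerDl.
Qed.

Variables (w : region -> rat) (m : nat) (eps : int -> 'rV[rat]_m).

Definition hweight (x b : int) : rat := w [fset TriL (x - 1)%R b; TriR x b].

(** Weighted paths from an edge on the line [x] to the right boundary. An edge crossed by a path
    carries no horizontal lozenge, so its weight is divided out of [stack_weight], which counts all
    edges. *)
Fixpoint rho (x : int) (Ps : seq (seq int)) (b : int) : 'rV[rat]_m :=
  if Ps is P :: Ps' then
    (\sum_(b' <- [:: b - 1; b] | b' \in P)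
        (hweight (x + 1) b')^-1 *: rho (x + 1) Ps' b')%R
  else eps b.

Lemma rho_cons x P Ps b : rho x (P :: Ps) b =
  (\sum_(b' <- [:: b - 1; b] | b' \in P) (hweight (x + 1) b')^-1 *: rho (x + 1) Ps b')%R.
Proof. by []. Qed.

Fixpoint stack_weight (x : int) (Ps : seq (seq int)) : rat :=
  if Ps is P :: Ps' then
    ((\prod_(b <- P) hweight (x + 1) b) * stack_weight (x + 1) Ps')%R
  else 1%R.

Hypothesis w_nz : forall x b, hweight x b != 0%R.
Hypothesis w0 : forall x b, w [fset TriR x b; TriL x b] = 1%R.
Hypothesis w1 : forall x b, w [fset TriR x b; TriL x (b - 1)%R] = 1%R.

Lemma pairwise_sub_eq (C P : seq int) : pairwise <%R C -> pairwise <%R P ->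
  {subset C <= P} -> size C = size P -> C = P.
Proof.
rewrite -!lt_sorted_pairwise => sC sP CP szCP.
apply: lt_sorted_eq => // b.
by have [] := uniq_min_size (lt_sorted_uniq sC) CP; rewrite ?szCP.
Qed.

Lemma M_stack x s P Ps :
  all (pairwise <%R) (P :: Ps) -> pairwise <%R s -> size s = m ->
  size (last P Ps) = m -> rowdet [seq eps b | b <- last P Ps] = 1%R ->
  (forall b, hweight (x + (size Ps).+1%:Z) b = 1)%R ->
  M w [fset t in stack x s (P :: Ps)] =
  (stack_weight x (P :: Ps) * rowdet [seq rho x (P :: Ps) b | b <- s])%R.
Proof.
elim: Ps x s P => [|P' Ps IH] x s P.
  move=> /andP[pwP _] pws szs /= szP detP wlast.
  have := @match_strip w x fset0 m (fun b => (hweight (x + 1) b)^-1 *: eps b)%R P 1.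
  move=> /(_ _ _ _ (w0 x) (w1 x)) H.
  have := H _ _ _ _ s [::]; rewrite {H} /= add0n => H.
  rewrite big1 ?mulr1 ?mul1r => [|b _]; last exact: wlast.
  rewrite -[RHS]mul1r -H // => [|C pwC CP szC].
    rewrite fset0U; congr (M w _); apply/fsetP => t.
    by rewrite !mem_fset_seq cats0 filter_predT.
  (* On the last line there are as many edges as paths, so [C] is everything and the empty region
     remains. *)
  rewrite (pairwise_sub_eq pwC pwP CP) ?szP // mul1r.
  rewrite (eq_map (g := eps)) => [|b]; last by rewrite wlast invr1 scale1r.
  rewrite detP fset0U -[RHS](M0 w); congr (M w _); apply/fsetP => t.
  by rewrite mem_fset_seq (eq_in_filter (a2 := pred0)) ?filter_pred0 // => b ->.
move=> /andP[pwP pwPs] pws szs szl detl wlast.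
pose Z := [fset t in stack (x + 1)%R P (P' :: Ps)].
have ltx : (x < x + 1)%R by rewrite ltrDl.
have ltx' : (x - 1 < x + 1)%R by apply: lt_trans ltx; rewrite gtrBl.
have notin_le (y : int) : (y < x + 1)%R -> (forall b, TriR y b \notin Z) /\
   (forall b, TriL y b \notin Z).
  move=> lty; split=> b; rewrite mem_fset_seq; apply/negP.
    by move=> /stackR; rewrite leNgt lty.
  by move=> /stackL; rewrite leNgt lty.
have [ZR ZL] := notin_le _ ltx; have [_ ZL'] := notin_le _ ltx'.
transitivity (M w (Z `|` [fset t in Rcol x s ++ Lcol x [seq b <- P | b \notin [::]]])).
  congr (M w _); apply/fsetP => t; rewrite mem_fsetU_seq !mem_fset_seq filter_predT.
  rewrite -[stack x _ _]/(Rcol x s ++ Lcol x P ++ stack (x + 1)%R P (P' :: Ps)).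
  by move: (stack (x + 1)%R _ _) => st; rewrite !mem_cat [RHS]orbC orbA.
apply: (@match_strip w x Z m
  (fun b => (hweight (x + 1) b)^-1 *: rho (x + 1) (P' :: Ps) b)%R P
  (stack_weight x [:: P, P' & Ps]) ZR ZL ZL' (w0 x) (w1 x) _ s [::]) => // C pwC CP szC.
pose Z' := [fset t in Lcol (x + 1)%R P' ++ stack (x + 1 + 1)%R P' Ps].
have Z'R b : TriR (x + 1)%R b \notin Z'.
  rewrite mem_fset_seq mem_cat mem_Lcol /=; apply/negP => /stackR.
  by rewrite leNgt ltrDl.
have -> : Z `|` [fset t in Lcol x [seq b <- P | b \notin C]] =
   Z' `|` [fset t in Lcol x [seq b <- P | b \notin C] ++ Rcol (x + 1)%R P].
  apply/fsetP => t; rewrite !mem_fsetU_seq !mem_fset_seq.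
  rewrite -[stack _ _ _]/(Rcol (x + 1)%R P ++ Lcol (x + 1)%R P' ++ stack (x + 1 + 1)%R P' Ps).
  by move: (Lcol _ P' ++ _) => st; rewrite !mem_cat; do 3!case: (t \in _).
have subZ t : t \in Z' -> t \in Z by rewrite !mem_fset_seq [in X in _ -> X]mem_cat => ->; rewrite orbT.
have uP : uniq P by apply: lt_sorted_uniq; rewrite lt_sorted_pairwise.
rewrite (match_horizontal w (D := P)) //.
- rewrite (_ : [seq b <- P | b \notin [seq b <- P | b \notin C]] = C); last first.
    apply: pairwise_sub_eq => //.
    + exact: pairwise_filter.
    + by move=> b; rewrite !mem_filter => /andP[+ bP]; rewrite bP andbT negbK.
    + apply/eqP; rewrite eqn_leq !uniq_leq_size ?filter_uniq //.
      * by apply: lt_sorted_uniq; rewrite lt_sorted_pairwise.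
      * by move=> b bC; rewrite !mem_filter CP // bC.
      * by move=> b; rewrite !mem_filter => /andP[+ bP]; rewrite bP andbT negbK.
  rewrite (_ : Z' `|` _ = [fset t in stack (x + 1)%R C (P' :: Ps)]); last first.
    by apply/fsetP => t; rewrite mem_fsetU_seq !mem_fset_seq [RHS]mem_cat orbC.
  rewrite IH //; last first.
    by move=> b; rewrite -addrA -intS; apply: wlast.
  rewrite rowdet_scale // -[stack_weight x _]/
    ((\prod_(b <- P) hweight (x + 1) b) * stack_weight (x + 1) (P' :: Ps))%R.
  (* The horizontal lozenges in use lie over [P] minus [C]; the factors over [C] cancel against the
     inverses in [rho]. *)
  have -> : (\prod_(b <- P) hweight (x + 1) b =
     (\prod_(b <- C) hweight (x + 1) b) *
     \prod_(b <- P | b \notin C) hweight (x + 1) b)%R.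
    rewrite (bigID (mem C)) /= -big_filter; congr (_ * _)%R; apply: perm_big.
    apply: uniq_perm; rewrite ?filter_uniq //.
      by apply: lt_sorted_uniq; rewrite lt_sorted_pairwise.
    by move=> b; rewrite mem_filter /=; case: (boolP (b \in C)) => //= /CP.
  have hw b : w [fset TriL x b; TriR (x + 1)%R b] = hweight (x + 1)%R b.
    by rewrite /hweight addrK.
  rewrite big_filter (eq_bigr _ (fun b _ => hw b)) prodfV.
  have nzC : (\prod_(b <- C) hweight (x + 1) b != 0)%R 
    by rewrite prodf_seq_neq0; apply/allP => b _; rewrite w_nz implybT.
  move: nzC; move: (\prod_(b <- C) _)%R (\prod_(b <- P | _) _)%R => u v nz_u.
  move: (stack_weight _ _) (rowdet _) => sw rd.
  by rewrite -mulrA [(u * v * _)%R]mulrC; field.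
- by move=> b; apply: contra (ZR b) => /subZ.
- by move=> b; apply: contra (ZL b) => /subZ.
- by rewrite filter_uniq.
- by move=> b; rewrite mem_filter => /andP[].
Qed.
End Stack.

(** * Passing to the complementary determinant *)

(** Completing [L], and likewise [W], by unit rows and multiplying by [row_mx V^T B] gives a block
    triangular matrix each time. Eliminating [\det (row_mx V^T B)] between the two identities gives
    the claim. *)
Lemma det_complementary (R : comNzRingType) (m n : nat)
    (L : 'M[R]_(m, n + m)) (B : 'M[R]_(n + m, m)) (V W : 'M[R]_(n, n + m)) :
  L *m V^T = 0 -> W *m B = 0 ->
  \det (lsubmx W) * (\det (lsubmx V) * \det (L *m B)) =
  \det (W *m V^T) * \det (dsubmx B) * \det (rsubmx L).
Proof.
move=> LV WB.
have eq1 : \det (rsubmx L) * \det (row_mx V^T B) = \det (lsubmx V) * \det (L *m B).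
  have := det_mulmx (col_mx (row_mx 1%:M 0) L) (row_mx V^T B).
  rewrite -[in col_mx _ L](hsubmxK L) -/(block_mx _ _ _ _) det_lblock det1 mul1r => <-.
  rewrite mul_col_row hsubmxK LV det_ublock; congr (_ * _).
  by rewrite -[V in V^T](hsubmxK V) tr_row_mx mul_row_col mul1mx mul0mx addr0 det_tr.
have eq2 : \det (lsubmx W) * \det (row_mx V^T B) = \det (W *m V^T) * \det (dsubmx B).
  have := det_mulmx (col_mx W (row_mx 0 1%:M)) (row_mx V^T B).
  rewrite -[in col_mx W _](hsubmxK W) -/(block_mx _ _ _ _) det_ublock det1 mulr1 => <-.
  rewrite mul_col_row hsubmxK WB det_lblock; congr (_ * _).
  by rewrite -[B in row_mx 0 _ *m B](vsubmxK B) mul_row_col mul0mx mul1mx add0r.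
by rewrite -eq1 mulrCA eq2 mulrC.
Qed.

(** * Path recursions on both halves and the functions orthogonal to them *)

Section Paths.
Variables (m n Lam : nat) (l : nat -> nat).
Hypothesis l_incr : {homo l : i j / (i < j)%N}.
Hypothesis l0_gt0 : (0 < l 0)%N.
Hypothesis l_Lam : forall c, (Lam < l c)%N = (n <= c)%N.

Lemma l_mono : {mono l : i j / (i < j)%N}.
Proof. exact: leqW_mono (leq_mono l_incr). Qed.

Lemma l_ge c : (c < l c)%N.
Proof. by elim: c => // c IH; apply: leq_ltn_trans IH (l_incr _). Qed.

(** Transports [phi], given on the levels of the axis, to the line [- a]: a path on the left half
    keeps its level or goes down by one. The target is a module because both the rows of [B] and
    scalar functions are transported. *)
Fixpoint Lmap (V : lmodType rat) (a : nat) (phi : nat -> V) (c : nat) : V :=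
  if a is a'.+1 then
    (if (a' < l c)%N then Lmap a' phi c else 0) +
    (if (0 < c)%N && (a' < l c.-1)%N then Lmap a' phi c.-1 else 0)
  else phi c.

Lemma Lmap_sum (V : lmodType rat) a (phi : nat -> V) c : (c < n + m)%N ->
  Lmap a phi c =
  \sum_(s < n + m) Lmap a (fun s' => (s' == s)%:R : rat^o) c *: phi s.
Proof.
elim: a c => [|a IH] c lt_c /=.
  rewrite (bigD1 (Ordinal lt_c)) //= eqxx scale1r big1 ?addr0 // => s.
  by rewrite -val_eqE /= eq_sym => /negbTE ->; rewrite scale0r.
have lt_c1 : (c.-1 < n + m)%N by apply: leq_ltn_trans (leq_pred _) lt_c.
rewrite (IH _ lt_c) (IH _ lt_c1).
under [RHS]eq_bigr do rewrite scalerDl.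
rewrite big_split /=; congr (_ + _); case: ifP => // _.
  by rewrite big1 // => s _; rewrite scale0r.
by rewrite big1 // => s _; rewrite scale0r.
Qed.

Lemma Lmap_delta_lt a c s : (c < s)%N ->
  Lmap a (fun s' => (s' == s)%:R : rat^o) c = 0.
Proof.
elim: a c => [|a IH] c lt_cs /=; first by rewrite ltn_eqF.
rewrite !IH ?(leq_ltn_trans (leq_pred _) lt_cs) //.
by rewrite !if_same addr0.
Qed.

Lemma Lmap_delta_eq a c : (n <= c)%N -> (a <= Lam.+1)%N ->
  Lmap a (fun s' => (s' == c)%:R : rat^o) c = 1.
Proof.
move=> le_nc; elim: a => [|a IH] le_a /=; first by rewrite eqxx.
rewrite IH ?(ltnW le_a) //.
have -> : (a < l c)%N by rewrite (leq_ltn_trans _ (_ : Lam < l c)%N) ?l_Lam.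
by case: ltnP => //= c_gt0; rewrite Lmap_delta_lt ?prednK ?if_same ?addr0.
Qed.

(** The inverse weight of the horizontal lozenge at level [c] on the line [a]: the special ones
    weigh 1/2. *)
Definition dbl (a c : nat) : rat := if (c < n)%N && (l c == a) then 2 else 1.

(* [Rrec h] lives on the line [Lam.+1 - h]. *)
Fixpoint Rrec (h c : nat) : 'rV[rat]_m :=
  if h is h'.+1 then
    (if (Lam - h' < l c)%N then dbl (Lam - h').+1 c *: Rrec h' c else 0) +
    (if (c.+1 < n + m)%N && (Lam - h' < l c.+1)%N
     then dbl (Lam - h').+1 c.+1 *: Rrec h' c.+1 else 0)
  else \row_i (c == n + i)%N%:R.

Lemma Rrec_gt h c (i : 'I_m) : (n + i < c)%N -> Rrec h c 0 i = 0.
Proof.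
elim: h c => [|h IH] c lt_ic /=; first by rewrite !mxE gtn_eqF.
by rewrite mxE; do 2!case: ifP => _; rewrite !mxE ?IH ?mulr0 ?addr0 // ltnW.
Qed.

Lemma Rrec_eq h (i : 'I_m) : Rrec h (n + i) 0 i = 1.
Proof.
elim: h => [|h IH] /=; first by rewrite !mxE eqxx.
have -> : (Lam - h < l (n + i))%N.
  by apply: leq_ltn_trans (leq_subr _ _) _; rewrite l_Lam leq_addr.
rewrite mxE mxE IH /dbl ltnNge leq_addr mulr1.
by case: ifP => _; rewrite mxE ?Rrec_gt ?mulr0 ?addr0.
Qed.

(** The cut-off at [u < a] replaces truncated subtraction, so that Pascal's rule [pbinB] holds
    without side condition. *)
Definition pbin (u a e : nat) : rat := if (a <= u)%N then 'C(u - a, e)%:R else 0.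

Lemma pbinB u a e : pbin u.+1 a e.+1 - pbin u a e.+1 = pbin u.+1 a.+1 e.
Proof.
rewrite /pbin ltnS; case: (leqP a u) => le_au.
  by rewrite ltnW // subSn // binS subSS natrD addrC addKr.
rewrite subr0; case: ifP => // le_au'.
by have -> : (u.+1 - a = 0)%N by apply/eqP; rewrite subn_eq0.
Qed.

Section OnePart.
Variable p : nat.
Hypothesis lt_pn : (p < n)%N.
Let d := (l p).-1.
Let q := (d - p)%N.

Let l_p : l p = d.+1. Proof. by rewrite /d prednK // (leq_ltn_trans _ (l_ge p)). Qed.
Let le_pd : (p <= d)%N. Proof. by rewrite -ltnS -l_p l_ge. Qed.
Let qp : (q + p = d)%N. Proof. by rewrite subnK. Qed.

(** The continuation of [f_p] to the line [- a], up to the sign [(-1) ^+ c]: an [a]-fold backward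
    difference, which has become constant on the levels from [p] on when [a = d]. *)
Definition fcol (a c : nat) : rat := if (a <= d)%N then pbin (c + q) a (d - a) else 0.

(** The continuation of [g_p] to the line [a] of the right half. Its last nonzero line [d.+1 = l p]
    is the one with the special lozenge of level [p]. *)
Definition gcol (a c : nat) : rat :=
  if (a <= d)%N then pbin (c + q) a (d - a) + 2 * pbin (c + q) a (d - a).+1
  else if a == d.+1 then 2 else 0.

Lemma fcol_small a c : (c < p)%N -> fcol a c = 0.
Proof.
move=> lt_cp; rewrite /fcol; case: ifP => // le_ad.
have lt_d : (c + q < d)%N by rewrite -qp addnC ltn_add2l.
by rewrite /pbin; case: ifP => // le_a; rewrite bin_small //; lia.
Qed.

Lemma fcol_gt a c : (d < a)%N -> fcol a c = 0.
Proof. by move=> gt_ad; rewrite /fcol leqNgt gt_ad. Qed.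

Lemma gcol_small a c : (a <= d)%N -> (c < p)%N -> gcol a c = 0.
Proof.
move=> le_ad lt_cp; rewrite /gcol le_ad.
have lt_d : (c + q < d)%N by rewrite -qp addnC ltn_add2l.
have z e : (d - a <= e)%N -> pbin (c + q) a e = 0.
  move=> le_e; rewrite /pbin; case: ifP => // le_a.
  by rewrite bin_small //; lia.
by rewrite !z // mulr0 addr0.
Qed.

Lemma fcol_diag a : (a <= d)%N -> fcol a p = 1.
Proof. by move=> le_ad; rewrite /fcol le_ad addnC qp /pbin le_ad binn. Qed.

Lemma gcol_diag a : (a <= d)%N -> gcol a p = 1.
Proof.
by move=> le_ad; rewrite /gcol le_ad addnC qp /pbin le_ad binn bin_small ?mulr0 ?addr0.
Qed.

Lemma fcol_step a c : (a < d)%N -> fcol a.+1 c = fcol a c - (if (0 < c)%N then fcol a c.-1 else 0).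
Proof.
move=> lt_ad; case: c => [|c] /=.
  rewrite subr0; case: (posnP p) => [p0|p_gt0]; last by rewrite !fcol_small.
  by rewrite -[X in fcol _ X]p0 -[X in _ = fcol _ X]p0 !fcol_diag // ltnW.
rewrite /fcol lt_ad (ltnW lt_ad) !addSn.
have -> : (d - a = (d - a.+1).+1)%N by lia.
by rewrite pbinB.
Qed.

Lemma gcol_step a c : (a < d)%N -> gcol a.+1 c = gcol a c - (if (0 < c)%N then gcol a c.-1 else 0).
Proof.
move=> lt_ad; case: c => [|c] /=.
  rewrite subr0; case: (posnP p) => [p0|p_gt0]; last by rewrite !gcol_small // ltnW.
  by rewrite -[X in gcol _ X]p0 -[X in _ = gcol _ X]p0 !gcol_diag // ltnW.
rewrite /gcol lt_ad (ltnW lt_ad) !addSn.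
have -> : (d - a = (d - a.+1).+1)%N by lia.
by rewrite -!pbinB; ring.
Qed.

Lemma gcol_last c : (p <= c)%N -> gcol d c = 1 + 2 * (c - p)%:R.
Proof.
move=> le_pc; rewrite /gcol leqnn subnn /pbin.
have -> : (d <= c + q)%N by lia.
by rewrite bin0 bin1; congr (_ + 2 * _%:R); lia.
Qed.

(** The alternating sign turns the recursion into a backward difference. A closed level [c.-1] is
    harmless because [fcol] vanishes there, and at [a = d] two ones cancel. For [a] beyond [d] the
    value is 0, which gives orthogonality to the rows of [L]. *)
Lemma Lmap_fcol a c : (a < l c)%N ->
  Lmap a (fun s => (-1) ^+ s * fcol 0 s : rat^o) c = (-1) ^+ c * fcol a c.
Proof.
elim: a c => [|a IH] c lt_a //=.
rewrite (ltnW lt_a) IH; last exact: ltnW.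
have -> : (if (0 < c)%N && (a < l c.-1)%N then
     Lmap a (fun s => (-1) ^+ s * fcol 0 s : rat^o) c.-1 else 0) =
    - ((-1) ^+ c * (if (0 < c)%N && (a < l c.-1)%N then fcol a c.-1 else 0)).
  case: c lt_a => [|c] lt_a /=; first by rewrite mulr0 oppr0.
  by case: ifP => [/IH->|_]; rewrite ?mulr0 ?oppr0 // exprS mulN1r mulNr opprK.
rewrite -mulrBr; congr (_ * _).
case: (ltngtP a d) => [lt_ad|gt_ad|eq_ad].
- rewrite fcol_step //; congr (_ - _); case: (posnP c) => //= c_gt0.
  case: ifP => // /negbT; rewrite -leqNgt => le_la.
  by rewrite fcol_small // -l_mono (leq_ltn_trans le_la) // l_p ltnW.
- by rewrite !fcol_gt ?if_same ?subr0 // ltnW.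
- have lt_pc : (p < c)%N by rewrite -l_mono l_p -eq_ad.
  have c_gt0 : (0 < c)%N by apply: leq_ltn_trans lt_pc.
  have le_pc : (p <= c.-1)%N by rewrite -ltnS prednK.
  have -> : (a < l c.-1)%N by rewrite eq_ad -l_p (leq_mono l_incr).
  rewrite c_gt0 /= /fcol eq_ad ltnn leqnn subnn /pbin !bin0.
  have -> : (d <= c + q)%N by lia.
  have -> : (d <= c.-1 + q)%N by lia.
  by rewrite subrr.
Qed.

(** The delicate line is [a = d], where [gcol] is [1 + 2 * (c - p)]: for [c > p] the difference is
    2, and for [c = p] the value 1 is doubled by the special lozenge. The resulting constant 2 is
    then killed by one more difference. *)
Lemma gcol_trans a c : (a < l c)%N ->
  gcol a.+1 c = dbl a.+1 c *
    (gcol a c - (if (0 < c)%N && (a <= l c.-1)%N then gcol a c.-1 else 0)).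
Proof.
move=> lt_a; case: (ltngtP a d) => [lt_ad|gt_ad|eq_ad].
- case: (ltnP c p) => [lt_cp|le_pc].
    rewrite !gcol_small ?(ltnW lt_ad) //; last by apply: leq_ltn_trans lt_cp; apply: leq_pred.
    by rewrite if_same subr0 mulr0.
  have -> : dbl a.+1 c = 1.
    rewrite /dbl ifF //; apply/negbTE; rewrite negb_and -leqNgt neq_ltn.
    have : (l p <= l c)%N by rewrite (leq_mono l_incr).
    by rewrite l_p => le_dc; rewrite (leq_trans _ le_dc) ?orbT.
  rewrite mul1r gcol_step //; congr (_ - _); case: (posnP c) => //= c_gt0.
  case: ifP => // /negbT; rewrite -ltnNge => lt_la.
  by rewrite gcol_small ?(ltnW lt_ad) // -l_mono (ltn_trans lt_la) // l_p ltnS ltnW.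
- have -> : gcol a.+1 c = 0 by rewrite /gcol !ifN //; lia.
  case: (eqVneq a d.+1) => [eq_a|ne_a]; last first.
    have z c' : gcol a c' = 0 by rewrite /gcol !ifN //; lia.
    by rewrite !z if_same subr0 mulr0.
  have lt_pc : (p < c)%N by rewrite -l_mono l_p -eq_a.
  have c_gt0 : (0 < c)%N by apply: leq_ltn_trans lt_pc.
  have -> : (a <= l c.-1)%N by rewrite eq_a -l_p (leq_mono l_incr) -ltnS prednK.
  have z c' : gcol a c' = 2 by rewrite /gcol eq_a ltnn eqxx.
  by rewrite !z c_gt0 subrr mulr0.
- have le_pc : (p <= c)%N by rewrite -(leq_mono l_incr) l_p -eq_ad.
  have -> : gcol a.+1 c = 2 by rewrite /gcol eq_ad ltnn eqxx.
  rewrite eq_ad gcol_last //.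
  move: le_pc; rewrite leq_eqVlt => /orP[/eqP <-|lt_pc].
    rewrite /dbl lt_pn l_p eqxx subnn mulr0 addr0 /=.
    case: ifP => [/andP[p_gt0 _]|_]; last by rewrite subr0 mulr1.
    by rewrite gcol_small ?subr0 ?mulr1 // prednK.
  have c_gt0 : (0 < c)%N by apply: leq_ltn_trans lt_pc.
  have le_pc : (p <= c.-1)%N by rewrite -ltnS prednK.
  have -> : (d <= l c.-1)%N by apply: ltnW; rewrite -l_p (leq_mono l_incr).
  have -> : dbl d.+1 c = 1.
    rewrite /dbl ifF //; apply/negbTE; rewrite negb_and -l_p orbC neq_ltn.
    by rewrite !l_mono lt_pc orbT.
  rewrite c_gt0 gcol_last // mul1r.
  have -> : (c - p = (c.-1 - p).+1)%N by lia.
  by rewrite -[(c.-1 - p).+1]addn1 natrD /=; ring.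
Qed.

(** Summation by parts: the step of [Rrec] from one line to the next is transposed onto [gcol], so
    the pairing has the same value on consecutive lines. *)
Lemma gcol_Rrec_step a : (a <= Lam)%N ->
  \sum_(c < n + m | (a <= l c)%N) ((-1) ^+ c * gcol a c) *: Rrec (Lam.+1 - a) c =
  \sum_(c < n + m | (a.+1 <= l c)%N) ((-1) ^+ c * gcol a.+1 c) *: Rrec (Lam - a) c.
Proof.
move=> le_a; rewrite subSn // [LHS]big_mkcond [RHS]big_mkcond /=.
have subK : (Lam - (Lam - a) = a)%N by rewrite subKn.
pose F c := if (a < l c)%N then ((-1) ^+ c * (dbl a.+1 c * gcol a c)) *: Rrec (Lam - a) c else 0.
(* [F] collects the steps that keep the level and [H c] those from [c] up to [c.+1]; the latter are
   reindexed by their target. *)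
pose H c := if (a <= l c)%N && (a < l c.+1)%N then
   ((-1) ^+ c * (dbl a.+1 c.+1 * gcol a c)) *: Rrec (Lam - a) c.+1 else 0.
transitivity (\sum_(c < n + m) (F c + (if (c.+1 < n + m)%N then H c else 0))).
  apply: eq_bigr => c _; rewrite subK /F /H; case: (leqP a (l c)) => [le_al|lt_la].
    rewrite scalerDr; congr (_ + _); first by case: ifP; rewrite ?scaler0 // scalerA mulrAC mulrA.
    by case: (_ < n + m)%N; case: (a < _)%N; rewrite /= ?scaler0 // scalerA mulrAC mulrA.
  by rewrite ltnNge (ltnW lt_la) if_same addr0.
transitivity (\sum_(c < n + m) (F c + (if (0 < c)%N then H c.-1 else 0))).
  rewrite !big_split /=; congr (_ + _).
  case: (n + m)%N => [|N]; first by rewrite !big_ord0.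
  rewrite big_ord_recr [RHS]big_ord_recl /= ltnn addr0 add0r.
  by apply: eq_bigr => c _; rewrite ltnS ltn_ord.
apply: eq_bigr => c _; rewrite /F /H; case: ifP => lt_a.
  rewrite gcol_trans //; case: (posnP c) => [->|c_gt0] /=.
    by rewrite subr0 addr0.
  rewrite prednK // lt_a andbT; case: ifP => _; last by rewrite subr0 addr0.
  rewrite -scalerDl; congr (_ *: _).
  have -> : (-1) ^+ c = - (-1) ^+ c.-1 :> rat by rewrite -{1}(prednK c_gt0) exprS mulN1r.
  ring.
case: posnP => [|c_gt0]; rewrite ?addr0 //=.
by rewrite prednK // lt_a andbF addr0.
Qed.

(** The pairing can be moved to the line [Lam.+1], which lies beyond [l p], where [gcol] is 0. *)
Lemma gcol_Rrec : \sum_(c < n + m) ((-1) ^+ c * gcol 0 c) *: Rrec Lam.+1 c = 0.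
Proof.
have step a : (a <= Lam.+1)%N ->
  \sum_(c < n + m) ((-1) ^+ c * gcol 0 c) *: Rrec Lam.+1 c =
  \sum_(c < n + m | (a <= l c)%N) ((-1) ^+ c * gcol a c) *: Rrec (Lam.+1 - a) c.
  elim: a => [|a IH] le_a; first by rewrite subn0; apply: eq_bigl => c.
  by rewrite IH ?(ltnW le_a) // gcol_Rrec_step.
rewrite (step Lam.+1) // big1 // => c _.
have : (l p <= Lam)%N by rewrite leqNgt l_Lam -ltnNge.
rewrite l_p => le_d; rewrite /gcol !ifN ?mulr0 ?scale0r //; lia.
Qed.

End OnePart.

Lemma fcol0E p s : (p < n)%N -> fcol p 0 s = 'C(s + ((l p).-1 - p), (l p).-1)%:R.
Proof. by move=> lt_pn; rewrite /fcol /pbin /= !subn0. Qed.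

Lemma gcol0E p s : (p < n)%N -> gcol p 0 s = fcol p 0 s + 2 * \sum_(t < s) fcol p 0 t.
Proof.
move=> lt_pn; rewrite /gcol /fcol /pbin /= !subn0; congr (_ + 2 * _).
elim: s => [|s IH]; last by rewrite big_ord_recr /= -IH subn0 addSn binS natrD.
rewrite big_ord0 add0n bin_small //.
by rewrite ltnS leq_subLR leq_addl.
Qed.

Theorem det_paths :
  rowdet [seq Lmap Lam (Rrec Lam.+1) c | c <- iota n m] =
  \det (\matrix_(i < n, j < n) \sum_(s < n + m) gcol i 0 s * fcol j 0 s).
Proof.
pose L : 'M[rat]_(m, n + m) :=
  \matrix_(i, s) Lmap Lam (fun s' => (s' == s)%:R : rat^o) (n + i).
pose B : 'M[rat]_(n + m, m) := \matrix_s Rrec Lam.+1 s.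
pose V : 'M[rat]_(n, n + m) := \matrix_(i, s) ((-1) ^+ s * fcol i 0 s).
pose W : 'M[rat]_(n, n + m) := \matrix_(i, s) ((-1) ^+ s * gcol i 0 s).
have -> : rowdet [seq Lmap Lam (Rrec Lam.+1) c | c <- iota n m] = \det (L *m B).
  congr (\det _); apply/row_matrixP => i; rewrite rowK.
  rewrite (nth_map 0%N) ?size_iota // nth_iota // Lmap_sum ?ltn_add2l //.
  apply/rowP => j; rewrite !mxE summxE; apply: eq_bigr => s _.
  by rewrite !mxE.
have LV : L *m V^T = 0.
  apply/matrixP => i j; rewrite !mxE.
  have := @Lmap_fcol j (ltn_ord j) Lam (n + i).
  rewrite l_Lam leq_addr => /(_ isT); rewrite fcol_gt; last first.
    by rewrite prednK ?(leq_ltn_trans _ (l_ge j)) // leqNgt l_Lam -ltnNge.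
  rewrite mulr0 Lmap_sum ?ltn_add2l // => E; rewrite -[RHS]E.
  by apply: eq_bigr => s _; rewrite !mxE.
have WB : W *m B = 0.
  apply/matrixP => i j; rewrite !mxE.
  have /matrixP/(_ 0 j) := gcol_Rrec (ltn_ord i).
  rewrite summxE mxE => E; rewrite -[RHS]E.
  by apply: eq_bigr => s _; rewrite !mxE.
have BE s j : B s j = Rrec Lam.+1 s 0 j by rewrite mxE.
have := det_complementary LV WB.
(* Levels change monotonically along each half, so the blocks of [B] and [L] on the levels from [n]
   on are unitriangular. *)
have -> : \det (dsubmx B) = 1.
  rewrite -det_tr det_trig.
    by rewrite big1 // => i _; rewrite mxE mxE BE; apply: Rrec_eq.
  apply/is_trig_mxP => i j lt_ij; rewrite mxE mxE BE.
  by apply: Rrec_gt; rewrite /= ltn_add2l.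
have -> : \det (rsubmx L) = 1.
  rewrite det_trig.
    by rewrite big1 // => i _; rewrite !mxE /= Lmap_delta_eq ?leq_addr.
  by apply/is_trig_mxP => i j lt_ij; rewrite !mxE /= Lmap_delta_lt // ltn_add2l.
(* The left blocks of [V] and [W] are triangular with the same diagonal of signs, so their
   determinants multiply to 1. *)
have trig (F : nat -> nat -> nat -> rat) :
   (forall p s, (p < n)%N -> (s < p)%N -> F p 0%N s = 0) ->
   (forall p, (p < n)%N -> F p 0%N p = 1) ->
   \det (lsubmx (\matrix_(i < n, s < n + m) ((-1) ^+ s * F i 0%N s))) =
   \prod_(i < n) (-1) ^+ i.
  move=> F0 F1; rewrite -det_tr det_trig.
    by apply: eq_bigr => i _; rewrite !mxE /= F1 ?mulr1.
  by apply/is_trig_mxP => i j lt_ij; rewrite !mxE /= F0 ?mulr0.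
rewrite (trig fcol); [|by move=> p s ? ?; apply: fcol_small|by move=> p ?; apply: fcol_diag].
rewrite (trig gcol); [|by move=> p s ? ?; apply: gcol_small|by move=> p ?; apply: gcol_diag].
rewrite mulrA -expr2 -prodrXl big1 => [|i _]; last by rewrite -exprM mulnC exprM sqrrN !expr1n.
rewrite mul1r !mulr1 => ->; congr (\det _); apply/matrixP => i j.
rewrite !mxE; apply: eq_bigr => s _; rewrite !mxE mulrACA -expr2 -exprM mulnC exprM.
by rewrite sqrrN !expr1n mul1r.
Qed.

End Paths.

(** * The region of the theorem *)

Section Region.
Variables (m n k : nat).
Hypothesis le_kn : (k <= n)%N.

Let lam := lam_nk n k.
Let Lam := (n + k)%N.

(* [lev n k c] is the part of [lam_nk n k] attached to the level [c < n];
   the levels [c >= n] are those of the hooks. *)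
Definition lev (c : nat) : nat := (c.+1 + (c.+1 - (n - k)))%N.

Lemma lev_incr : {homo lev : i j / (i < j)%N}.
Proof. by move=> i j; rewrite /lev; lia. Qed.

Lemma lev0_gt0 : (0 < lev 0)%N. Proof. by []. Qed.

Lemma lev_Lam c : (Lam < lev c)%N = (n <= c)%N.
Proof. by rewrite /lev /Lam; lia. Qed.

Lemma part_lev i : (1 <= i <= n)%N -> part lam i = lev (n - i).
Proof.
move=> i_rng; rewrite part_lam_nk // /lev; case: leqP; lia.
Qed.

Lemma part1_Lam : part lam 1 = Lam.
Proof.
case: (posnP n) => [n0|n_gt0].
  by rewrite /Lam /part /lam /lam_nk n0 /=; move: le_kn; rewrite n0; lia.
by rewrite part_lev ?n_gt0 // /lev /Lam; lia.
Qed.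

(** Level [c] runs at height [c] left of the axis and at [c - y] right of it. The inequality is
    strict only on the left, where the forced strip has been removed. *)
Definition line (y : int) : seq int :=
  if y <= 0 then [seq c%:Z | c <- iota 0 (n + m) & (`|y| < lev c)%N]
  else [seq c%:Z - y | c <- iota 0 (n + m) & (`|y| <= lev c)%N].

Fixpoint lines (x : int) (h : nat) : seq (seq int) :=
  if h is h'.+1 then line (x + 1) :: lines (x + 1) h' else [::].

Lemma linesS x h : lines x h.+1 = line (x + 1) :: lines (x + 1) h.
Proof. by []. Qed.

Lemma mem_line y b : (b \in line y) =
  if y <= 0 then [&& 0 <= b, b < (n + m)%:Z & (`|y| < lev `|b|)%N]
  else [&& 0 <= b + y, b + y < (n + m)%:Z & (`|y| <= lev `|(b + y)%R|)%N].
Proof.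
rewrite /line; case: ifP => _; apply/mapP/and3P => [[c]|[b0 bN lb]].
- by rewrite mem_filter mem_iota => /andP[lc cN] ->; rewrite absz_nat lc; split=> //; lia.
- exists `|b|%N; last lia.
  by rewrite mem_filter mem_iota lb /=; lia.
- rewrite mem_filter mem_iota => /andP[lc cN] ->.
  by rewrite subrK absz_nat lc; split=> //; lia.
- exists `|(b + y)%R|%N; last lia.
  by rewrite mem_filter mem_iota lb /=; lia.
Qed.

Lemma line_sorted y : pairwise <%R (line y).
Proof.
have pw (f : nat -> int) (a : pred nat) : {mono f : i j / (i < j)%N >-> i < j} ->
    pairwise <%R [seq f c | c <- iota 0 (n + m) & a c].
  move=> f_mono; rewrite pairwise_map.
  apply: (@sub_pairwise _ ltn) => [i j|]; first by rewrite /= f_mono.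
  by apply: pairwise_filter; rewrite -sorted_pairwise ?iota_ltn_sorted //; apply: ltn_trans.
by rewrite /line; case: ifP => _; apply: pw => i j; rewrite ?ltrD2r ltz_nat.
Qed.

Lemma lines_sorted x h : all (pairwise <%R) (lines x h).
Proof. by elim: h x => //= h IH x; rewrite line_sorted IH. Qed.

Lemma stack_linesR x h a b :
  (TriR a b \in stack x (line x) (lines x h)) = (x <= a < x + h%:Z) && (b \in line a).
Proof.
elim: h x => [|h IH] x /=; first by rewrite addr0; case: ltgtP.
rewrite !mem_cat mem_Rcol mem_Lcol IH /=.
have [->|ne_ax] := eqVneq a x.
  have -> : (x + 1 <= x) = false by lia.
  have -> : (x <= x < x + h.+1%:Z) by lia.
      by rewrite orbF.
by rewrite /=; congr (_ && _); lia.
Qed.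

Lemma stack_linesL x h a b :
  (TriL a b \in stack x (line x) (lines x h)) = (x <= a < x + h%:Z) && (b \in line (a + 1)).
Proof.
elim: h x => [|h IH] x /=; first by rewrite addr0; case: ltgtP.
rewrite !mem_cat mem_Rcol mem_Lcol IH /=.
have [->|ne_ax] := eqVneq a x.
  have -> : (x + 1 <= x) = false by lia.
  have -> : (x <= x < x + h.+1%:Z) by lia.
      by rewrite orbF.
by rewrite /=; congr (_ && _); lia.
Qed.

Lemma map_tri_R (f : int -> int) s a b :
  (TriR a b \in [seq TriR x (f x) | x <- s]) = (a \in s) && (b == f a).
Proof.
by apply/mapP/andP => [[x xs [-> ->]]|[a_s /eqP->]]; [rewrite xs|exists a].
Qed.

Lemma map_tri_L (f : int -> int) s a b :
  (TriL a b \in [seq TriL x (f x) | x <- s]) = (a \in s) && (b == f a).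
Proof.
by apply/mapP/andP => [[x xs [-> ->]]|[a_s /eqP->]]; [rewrite xs|exists a].
Qed.

Lemma map_tri_RL (f : int -> int) s a b :
  (TriR a b \in [seq TriL x (f x) | x <- s]) = false.
Proof. by apply/mapP => -[]. Qed.

Lemma map_tri_LR (f : int -> int) s a b :
  (TriL a b \in [seq TriR x (f x) | x <- s]) = false.
Proof. by apply/mapP => -[]. Qed.

Definition map_triE := (map_tri_R, map_tri_L, map_tri_RL, map_tri_LR).

(** The comparison is made level by level: the hooks are the levels from [n] to [n + m - 1], and the
    shifted hook of part [i] is the level [n - i]. *)
Lemma regionA_stack :
  regionA m lam = [fset t in stack (- Lam%:Z) (line (- Lam%:Z)) (lines (- Lam%:Z) (2 * Lam).+1)]%fset.
Proof.
apply/fsetP => t; rewrite /regionA !mem_fset_seq size_lam_nk mem_cat part1_Lam.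
case: t => a b; rewrite ?(stack_linesR, stack_linesL) mem_line.
  apply/orP/idP => [[]/flatten_mapP[c]|].
  - rewrite mem_index_iota => /andP[le_nc lt_c].
    have lc := lev_Lam c; rewrite le_nc in lc.
    rewrite /hook !mem_cat !map_triE ?orbF ?orFb !mem_zrange.
    move=> /orP[]/andP[a_rng /eqP->].
      have -> : a <= 0 by lia.
      by rewrite absz_nat; lia.
    rewrite subrK absz_nat; case: ifP => [a_le|a_gt]; last by lia.
    have a0 : a = 0 by lia.
    by rewrite a0 subr0 absz_nat; lia.
  - rewrite mem_index_iota => i_rng; rewrite part_lev //.
    have -> : n%:Z - c%:Z = (n - c)%N by lia.
    have : (n - c < n)%N by lia.
    move: (n - c)%N => {i_rng}c lt_cn; have c_lt : (c < lev c)%N by rewrite /lev; lia.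
    have le_L : (lev c <= Lam)%N by rewrite leqNgt lev_Lam -ltnNge.
    rewrite /shifted_hook !mem_cat !map_triE ?orbF ?orFb !mem_zrange !inE tri_eqE.
    move=> /or3P[]/andP[a_rng /eqP->].
    + have -> : a <= 0 by lia.
      by rewrite absz_nat; lia.
    + rewrite subrK absz_nat; case: ifP => [a_le|a_gt]; last by lia.
      have a0 : a = 0 by lia.
      by rewrite a0 subr0 absz_nat; lia.
    + have -> : a = lev c by lia.
      by rewrite subrK !absz_nat; case: ifP => ?; lia.
  - move=> /andP[a_rng]; case: ifP => a_sgn /and3P[b0 bN lb].
    + have [c bc] : exists c : nat, b = c%:Z by exists `|b|%N; lia.
      rewrite bc absz_nat in b0 bN lb *.
      case: (leqP n c) => [le_nc|lt_cn].
        left; apply/flatten_mapP; exists c; first by rewrite mem_index_iota; lia.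
        rewrite /hook !mem_cat !map_triE ?orbF ?orFb !mem_zrange.
        case: (ltP a 0) => a0; first by rewrite eqxx; lia.
        by apply/orP; right; lia.
      right; apply/flatten_mapP; exists (n - c)%N; first by rewrite mem_index_iota; lia.
      rewrite part_lev ?subKn ?(ltnW lt_cn) //; last by lia.
      have -> : n%:Z - (n - c)%:Z = c by lia.
      rewrite /shifted_hook !mem_cat !map_triE ?orbF ?orFb !mem_zrange.
      case: (ltP a 0) => a0; first by rewrite eqxx; lia.
      by apply/orP; right; apply/orP; left; lia.
    + have [c bc] : exists c : nat, b + a = c%:Z by exists `|(b + a)%R|%N; lia.
      rewrite bc absz_nat in b0 bN lb *.
      have {}bc : b = c%:Z - a by lia.
      case: (leqP n c) => [le_nc|lt_cn].
        left; apply/flatten_mapP; exists c; first by rewrite mem_index_iota; lia.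
        rewrite /hook !mem_cat !map_triE ?orbF ?orFb !mem_zrange.
        by apply/orP; right; rewrite bc eqxx; lia.
      right; apply/flatten_mapP; exists (n - c)%N; first by rewrite mem_index_iota; lia.
      rewrite part_lev ?subKn ?(ltnW lt_cn) //; last by lia.
      have -> : n%:Z - (n - c)%:Z = c by lia.
      rewrite /shifted_hook !mem_cat !map_triE ?orbF ?orFb !mem_zrange inE tri_eqE.
      by apply/orP; right; rewrite bc; lia.
apply/orP/idP => [[]/flatten_mapP[c]|].
- rewrite mem_index_iota => /andP[le_nc lt_c].
  have lc := lev_Lam c; rewrite le_nc in lc.
  rewrite /hook !mem_cat !map_triE ?orbF ?orFb !mem_zrange.
  move=> /orP[]/andP[a_rng /eqP->].
    have -> : a + 1 <= 0 by lia.
      by rewrite absz_nat; lia.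
  have -> : c%:Z - a - 1 + (a + 1) = c by lia.
  by rewrite absz_nat; case: ifP => ?; lia.
- rewrite mem_index_iota => i_rng; rewrite part_lev //.
  have -> : n%:Z - c%:Z = (n - c)%N by lia.
  have : (n - c < n)%N by lia.
  move: (n - c)%N => {i_rng}c lt_cn; have c_lt : (c < lev c)%N by rewrite /lev; lia.
    have le_L : (lev c <= Lam)%N by rewrite leqNgt lev_Lam -ltnNge.
  rewrite /shifted_hook !mem_cat !map_triE ?orbF ?orFb !mem_zrange ?inE ?tri_eqE ?orbF.
  move=> /orP[]/andP[a_rng /eqP->].
    have -> : a + 1 <= 0 by lia.
      by rewrite absz_nat; lia.
  have -> : c%:Z - a - 1 + (a + 1) = c by lia.
  by rewrite absz_nat; case: ifP => ?; lia.
- move=> /andP[a_rng]; case: ifP => a_sgn /and3P[b0 bN lb].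
  + have [c bc] : exists c : nat, b = c%:Z by exists `|b|%N; lia.
    rewrite bc absz_nat in b0 bN lb *.
    case: (leqP n c) => [le_nc|lt_cn].
      left; apply/flatten_mapP; exists c; first by rewrite mem_index_iota; lia.
      by rewrite /hook !mem_cat !map_triE ?orbF ?orFb !mem_zrange eqxx; lia.
    right; apply/flatten_mapP; exists (n - c)%N; first by rewrite mem_index_iota; lia.
    rewrite part_lev ?subKn ?(ltnW lt_cn) //; last by lia.
    have -> : n%:Z - (n - c)%:Z = c by lia.
    by rewrite /shifted_hook !mem_cat !map_triE ?orbF ?orFb !mem_zrange eqxx; lia.
  + have [c bc] : exists c : nat, b + (a + 1) = c%:Z by exists `|(b + (a + 1))%R|%N; lia.
    rewrite bc absz_nat in b0 bN lb *.
    have {}bc : b = c%:Z - a - 1 by lia.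
    case: (leqP n c) => [le_nc|lt_cn].
      left; apply/flatten_mapP; exists c; first by rewrite mem_index_iota; lia.
      by rewrite /hook !mem_cat !map_triE ?orbF ?orFb !mem_zrange bc eqxx; lia.
    right; apply/flatten_mapP; exists (n - c)%N; first by rewrite mem_index_iota; lia.
    rewrite part_lev ?subKn ?(ltnW lt_cn) //; last by lia.
    have -> : n%:Z - (n - c)%:Z = c by lia.
    by rewrite /shifted_hook !mem_cat !map_triE ?orbF ?orFb !mem_zrange bc eqxx; lia.
Qed.

Lemma special_lozenge_lev i : (1 <= i <= n)%N ->
  special_lozenge lam i =
  [fset TriL ((lev (n - i))%:Z - 1) ((n - i)%N%:Z - (lev (n - i))%:Z);
        TriR (lev (n - i))%:Z ((n - i)%N%:Z - (lev (n - i))%:Z)]%fset.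
Proof.
move=> i_rng; rewrite /special_lozenge part_lev // size_lam_nk.
by have -> : n%:Z - i%:Z = (n - i)%N by lia.
Qed.

(** A special lozenge has its triangles in two adjacent columns, so a lozenge inside one column is
    never special. *)
Lemma weightA_strip x b b' : weightA lam [fset TriR x b; TriL x b']%fset = 1.
Proof.
rewrite /weightA size_lam_nk ifN //; apply/hasPn => i; rewrite mem_index_iota => i_rng.
rewrite special_lozenge_lev //; move: (n - i)%N => c; move: (lev c) => v.
apply/eqP => /fsetP E.
have := E (TriR v (c%:Z - v%:Z)); have := E (TriL (v%:Z - 1) (c%:Z - v%:Z)).
rewrite !inE !tri_eqE !eqxx /= ?orbF ?orbT => /andP[/eqP e1 _] /andP[/eqP e2 _].
lia.
Qed.

Lemma hweightE y b : hweight (weightA lam) y b =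
  if [&& 0 < y, 0 <= b + y, b + y < n%:Z & lev `|(b + y)%R| == `|y|%N] then 1 / 2 else 1.
Proof.
rewrite /hweight /weightA size_lam_nk; congr (if _ then _ else _).
apply/hasP/and4P => [[i]|[y_gt0 c_ge0 c_lt /eqP lc]].
  rewrite mem_index_iota => i_rng; rewrite special_lozenge_lev //.
  have : (n - i < n)%N by lia.
  move: (n - i)%N => c lt_cn /eqP/fsetP E.
  have := E (TriR (lev c) (c%:Z - (lev c)%:Z)).
  rewrite !inE !tri_eqE !eqxx /= => /andP[/eqP <- /eqP <-].
  by rewrite subrK !absz_nat; split=> //; rewrite ?ltz_nat // /lev; lia.
exists (n - `|(b + y)%R|)%N; first by rewrite mem_index_iota; lia.
rewrite special_lozenge_lev; last by lia.
have -> : (n - (n - `|(b + y)%R|) = `|(b + y)%R|)%N by lia.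
rewrite lc; have -> : `|y|%N%:Z = y by lia.
by have -> : `|(b + y)%R|%N%:Z - y = b by lia.
Qed.

Lemma hweight_neq0 y b : hweight (weightA lam) y b != 0.
Proof. by rewrite hweightE; case: ifP. Qed.

Lemma hweight_left y b : y <= 0 -> hweight (weightA lam) y b = 1.
Proof. by move=> y_le0; rewrite hweightE ltNge y_le0. Qed.

Lemma hweight_right (a c : nat) :
  hweight (weightA lam) a.+1%:Z (c%:Z - a.+1%:Z) = (dbl n lev a.+1 c)^-1.
Proof.
rewrite hweightE subrK !absz_nat /dbl !ltz_nat /=.
by case: ifP; rewrite ?invr1 ?div1r.
Qed.

Definition end_row (b : int) : 'rV[rat]_m :=
  \row_i (b == (n + i)%N%:Z - Lam.+1%:Z)%:R.

Lemma mem_line_right (a c : nat) :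
  ((c%:Z - a.+1%:Z) \in line a.+1%:Z) = (c < n + m)%N && (a < lev c)%N.
Proof.
rewrite mem_line subrK !absz_nat; have -> : (a.+1%:Z <= 0) = false by lia.
by rewrite ltz_nat.
Qed.

Lemma mem_line_left (a c : nat) :
  (c%:Z \in line (- a%:Z)) = (c < n + m)%N && (a < lev c)%N.
Proof.
rewrite mem_line abszN !absz_nat; have -> : - a%:Z <= 0 by lia.
by rewrite ltz_nat.
Qed.

(** Right of the axis levels descend by one height per line, so the heights [b - 1] and [b] on the
    next line are the levels [c] and [c.+1]. *)
Lemma rho_right h c : (h <= Lam.+1)%N -> (c < n + m)%N ->
  rho (weightA lam) end_row (Lam.+1 - h)%N%:Z (lines (Lam.+1 - h)%N%:Z h)
      (c%:Z - (Lam.+1 - h)%N%:Z) = Rrec m n Lam lev h c.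
Proof.
elim: h c => [|h IH] c le_h lt_c.
  apply/rowP => i; rewrite !mxE subn0; congr (_%:R); congr nat_of_bool.
  by apply/eqP/eqP; lia.
rewrite linesS rho_cons.
have -> : (Lam.+1 - h.+1 = Lam - h)%N by lia.
have eL : (Lam.+1 - h = (Lam - h).+1)%N by lia.
have -> : (Lam - h)%N%:Z + 1 = (Lam - h).+1%:Z by lia.
have -> : c%:Z - (Lam - h)%N%:Z - 1 = c%:Z - (Lam - h).+1%:Z by lia.
have -> : c%:Z - (Lam - h)%N%:Z = c.+1%:Z - (Lam - h).+1%:Z by lia.
rewrite !big_cons big_nil !mem_line_right !hweight_right !invrK lt_c /=.
rewrite -eL; case: ifP => _; case: ifP => [/andP[lt_c1 _]|_]; rewrite ?IH ?addr0 ?add0r //; exact: ltnW.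
Qed.

Lemma rho_left a c : (c < n + m)%N ->
  rho (weightA lam) end_row (- a%:Z) (lines (- a%:Z) (Lam.+1 + a)) c%:Z =
  Lmap lev a (Rrec m n Lam lev Lam.+1) c.
Proof.
elim: a c => [|a IH] c lt_c.
  have := rho_right (leqnn _) lt_c; rewrite subnn !subr0 addn0 oppr0 => ->.
  by [].
rewrite addnS linesS rho_cons [Lmap _ _ _ _]/=.
have -> : - a.+1%:Z + 1 = - a%:Z by lia.
have hw b : hweight (weightA lam) (- a%:Z) b = 1 by apply: hweight_left; lia.
rewrite !big_cons big_nil !hw !invr1 !scale1r mem_line_left lt_c.
case: c lt_c => [|c] lt_c.
  have -> : 0%:Z - 1 \in line (- a%:Z) = false.
    by rewrite mem_line; have -> : - a%:Z <= 0 by lia.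
  by rewrite IH //= !addr0.
have -> : c.+1%:Z - 1 = c by lia.
have lt_c' : (c < n + m)%N by apply: ltnW.
rewrite mem_line_left lt_c' !IH //= addr0.
by do 2!case: ifP; rewrite ?addr0 ?add0r // addrC.
Qed.

Lemma filter_lev : [seq c <- iota 0 (n + m) | (Lam < lev c)%N] = iota n m.
Proof.
rewrite iotaD filter_cat (eq_in_filter (a2 := pred0)) => [|c]; last first.
  by rewrite mem_iota lev_Lam /= add0n ltnNge => /negbTE.
rewrite filter_pred0 add0n (eq_in_filter (a2 := predT)) ?filter_predT // => c.
by rewrite mem_iota lev_Lam => /andP[].
Qed.

Lemma line_start : line (- Lam%:Z) = [seq c%:Z | c <- iota n m].
Proof.
rewrite /line abszN absz_nat; have -> : - Lam%:Z <= 0 by lia.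
by rewrite filter_lev.
Qed.

Lemma line_end : line Lam.+1%:Z = [seq c%:Z - Lam.+1%:Z | c <- iota n m].
Proof. by rewrite /line absz_nat filter_lev. Qed.

Lemma last_lines x h : last (line x) (lines x h) = line (x + h%:Z).
Proof.
elim: h x => [|h IH] x /=; first by rewrite addr0.
by rewrite IH intS addrA.
Qed.

Lemma size_lines x h : size (lines x h) = h.
Proof. by elim: h x => //= h IH x; rewrite IH. Qed.

Lemma stack_weight_prod w x h :
  stack_weight w x (lines x h) =
  \prod_(i < h) \prod_(b <- line (x + i.+1%:Z)) hweight w (x + i.+1%:Z) b.
Proof.
elim: h x => [|h IH] x /=; first by rewrite big_ord0.
rewrite big_ord_recl IH; congr (_ * _).
apply: eq_bigr => i _; rewrite lift0.
by have -> : x + 1 + i.+1%:Z = x + i.+2%:Z by lia.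
Qed.

(** Every level [c < n] contributes a single factor 1/2, on the line [lev c]; all other edges have
    weight 1. *)
Lemma stack_weight_lines :
  stack_weight (weightA lam) (- Lam%:Z) (lines (- Lam%:Z) (2 * Lam).+1) = (1 / 2) ^+ n.
Proof.
rewrite stack_weight_prod; have -> : ((2 * Lam).+1 = Lam + Lam.+1)%N by lia.
rewrite big_split_ord /= [X in X * _]big1 ?mul1r => [|i _]; last first.
  apply: big1_seq => b _; apply: hweight_left.
  by have := ltn_ord i; lia.
transitivity (\prod_(i < Lam.+1) \prod_(c < n + m)
   (if (i < lev c)%N then (dbl n lev i.+1 c)^-1 else 1)).
  apply: eq_bigr => i _; have -> : - Lam%:Z + (Lam + i).+1%:Z = i.+1%:Z by lia.
  rewrite /line /= big_map big_filter -big_mkcond /= -[RHS](big_mkord (fun c => (i < lev c)%N)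
     (fun c => (dbl n lev i.+1 c)^-1)) /index_iota subn0.
  by apply: eq_bigr => c _; rewrite hweight_right.
rewrite exchange_big /= big_split_ord /= [X in _ * X]big1 ?mulr1 => [|c _]; last first.
  apply: big1 => i _; have -> : dbl n lev i.+1 (n + c) = 1 by rewrite /dbl ltnNge leq_addr.
  by rewrite invr1 if_same.
rewrite -[n in RHS]card_ord -prodr_const; apply: eq_bigr => c _.
have lev_gt0 : (0 < lev c)%N by [].
have lt_lev : ((lev c).-1 < Lam.+1)%N.
  by rewrite prednK // leqW // leqNgt lev_Lam -ltnNge.
rewrite (bigD1 (Ordinal lt_lev)) // big1 ?mulr1 => [|i ne_i].
  change (nat_of_ord (Ordinal lt_lev)) with (lev c).-1.
  by rewrite ltn_predL lev_gt0 /dbl ltn_ord prednK // eqxx ?div1r.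
have -> : dbl n lev i.+1 c = 1.
  rewrite /dbl ltn_ord ifN //; apply: contraNneq ne_i => e.
  by apply/eqP/val_inj; apply: esym (congr1 predn e).
by rewrite invr1 if_same.
Qed.

Theorem M_regionA :
  M (weightA lam) (regionA m lam) = (1 / 2) ^+ n *
  \det (\matrix_(i < n, j < n) \sum_(s < n + m) gcol lev i 0 s * fcol lev j 0 s).
Proof.
have size_ends y (f : nat -> int) : line y = [seq f c | c <- iota n m] -> size (line y) = m.
  by move=> ->; rewrite size_map size_iota.
have line_last : last (line (- Lam%:Z + 1)) (lines (- Lam%:Z + 1) (2 * Lam)) = line Lam.+1%:Z.
  by rewrite last_lines; congr line; lia.
rewrite regionA_stack linesS (@M_stack _ m end_row).
- rewrite -linesS stack_weight_lines -(det_paths m lev_incr lev0_gt0 lev_Lam); congr (_ * rowdet _).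
  rewrite line_start -map_comp; apply/eq_in_map => c; rewrite mem_iota => /andP[_ lt_c].
  have -> : ((2 * Lam).+1 = Lam.+1 + Lam)%N by lia.
  exact: rho_left.
- exact: hweight_neq0.
- by move=> x b; apply: weightA_strip.
- by move=> x b; apply: weightA_strip.
- by rewrite -linesS lines_sorted.
- exact: line_sorted.
- exact: size_ends line_start.
- by rewrite line_last (size_ends _ _ line_end).
- rewrite line_last line_end -map_comp; rewrite -[RHS](det1 _ m); congr (\det _).
  apply/matrixP => i j; rewrite mxE (nth_map 0%N) ?size_iota // nth_iota // !mxE /=.
  congr (_%:R); congr nat_of_bool; rewrite -val_eqE /=; apply/eqP/eqP; lia.
(* A special lozenge on the right boundary would need a level below [n] with [lev] equal to
   [Lam.+1], contrary to [lev_Lam]. *)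
- move=> b; have -> : - Lam%:Z + (size (lines (- Lam%:Z + 1) (2 * Lam))).+1%:Z = Lam.+1%:Z.
    by rewrite size_lines; lia.
  rewrite hweightE absz_nat; case: ifP => // /and4P[_ c_ge0 c_lt /eqP lc].
  by have := lev_Lam `|(b + Lam.+1%:Z)%R|; rewrite lc ltnS leqnn; lia.
Qed.

End Region.

(** * Skew forms and multiplicities of roots of determinants *)

Section SignForm.
Variable R : comNzRingType.

Definition sgn_mx N : 'M[R]_N := \matrix_(t, s) ((t < s)%:R - (s < t)%:R).

Definition K_mx N : 'M[R]_N := sgn_mx N + const_mx 1.

Lemma tr_sgn_mx N : (sgn_mx N)^T = - sgn_mx N.
Proof. by apply/matrixP => t s; rewrite !mxE opprB. Qed.

Lemma sgn_mx_block p q :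
  sgn_mx (p + q) = block_mx (sgn_mx p) (const_mx 1) (const_mx (-1)) (sgn_mx q).
Proof.
apply/matrixP => t s; rewrite -[t]splitK -[s]splitK.
case: (split t) => t'; case: (split s) => s' /=;
  rewrite ?(block_mxEul, block_mxEur, block_mxEdl, block_mxEdr) !mxE //=.
- by rewrite (leq_trans (ltn_ord t')) ?leq_addr // ltnNge (ltnW (leq_trans (ltn_ord t') _)) ?leq_addr // subr0.
- by rewrite (leq_trans (ltn_ord s')) ?leq_addr // ltnNge (ltnW (leq_trans (ltn_ord s') _)) ?leq_addr // sub0r.
- by rewrite !ltn_add2l.
Qed.

Lemma det_K_mx N : \det (K_mx N) = 1.
Proof.
rewrite -det_tr det_trig.
  by rewrite big1 // => i _; rewrite !mxE ltnn subrr add0r.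
by apply/is_trig_mxP => i j lt_ij; rewrite !mxE lt_ij ltnNge ltnW //= sub0r addNr.
Qed.

Lemma K_mxE N t s : K_mx N t s = if (t < s)%N then 2 else (t == s :> nat)%:R.
Proof.
rewrite !mxE; case: ltngtP => _; first by rewrite subr0.
  by rewrite sub0r addNr.
by rewrite subrr add0r.
Qed.

Lemma mul_K_mx n N (F : 'M[R]_(n, N)) : let u := F *m const_mx 1 : 'cV_n in
  F *m K_mx N *m F^T = F *m sgn_mx N *m F^T + u *m u^T.
Proof.
rewrite /= /K_mx mulmxDr mulmxDl; congr (_ + _).
rewrite trmx_mul trmx_const mulmxA -[in RHS](mulmxA F); congr (_ *m _ *m _).
by apply/matrixP => i j; rewrite !mxE big_ord1 !mxE mulr1.
Qed.

(** A Schur complement followed by linearity in the last row. For skew [A] the two determinants on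
    the right are skew of consecutive sizes, so one of them vanishes in odd size. *)
Lemma det_bordered n (A : 'M[R]_n) (u : 'cV[R]_n) :
  \det (A + u *m u^T) = \det A + \det (block_mx A u (- u^T) 0).
Proof.
have -> : \det (A + u *m u^T) = \det (block_mx A u (- u^T) 1).
  have -> : block_mx A u (- u^T) 1 =
      block_mx 1%:M u 0 1%:M *m block_mx (A + u *m u^T) 0 (- u^T) 1%:M.
    by rewrite mulmx_block !(mul1mx, mulmx1, mul0mx, mulmx0) mulmxN addrK !add0r.
  by rewrite det_mulmx det_ublock det_lblock !det1 !(mul1r, mulr1).
have -> : \det A = \det (block_mx A u 0 1%:M) by rewrite det_ublock det1 mulr1.
rewrite -[RHS]/(_ + _) -[X in X + _]mul1r -[X in _ + X]mul1r.
apply: (determinant_multilinear (i0 := rshift n (0 : 'I_1))).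
- rewrite /block_mx !rowKd !row_row_mx !scale1r add_row_mx !row0.
  by rewrite add0r addr0.
all: by rewrite /block_mx !row'Kd; congr (castmx _ (col_mx _ _)); apply/matrixP => -[].
Qed.

End SignForm.

Lemma det_skew_odd (R : idomainType) n (A : 'M[R]_n) :
  2%N \notin [pchar R] -> A^T = - A -> odd n -> \det A = 0.
Proof.
move=> ch2 skA on; have : \det A = - \det A.
  by rewrite -[LHS]det_tr skA -scaleN1r detZ -signr_odd on expr1 mulN1r.
move/eqP; rewrite -addr_eq0 -mulr2n -mulr_natl mulf_eq0.
by move: ch2; rewrite inE /= => /negbTE -> /= /eqP.
Qed.

Section Multiplicity.
Variable F : fieldType.

Lemma dvdp_det_rows n (A : 'M[{poly F}]_n) (p : {poly F}) r :
  (forall (i j : 'I_n), (i < r)%N -> p %| A i j) -> (r <= n)%N -> p ^+ r %| \det A.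
Proof.
move=> dvA le_rn.
pose A' := \matrix_(i, j) if (i < r)%N then A i j %/ p else A i j.
have -> : A = diag_mx (\row_i if (i < r)%N then p else 1) *m A'.
  apply/matrixP => i j; rewrite mul_diag_mx !mxE; case: ifP => lt_ir; last by rewrite mul1r.
  by rewrite mulrC divpK // dvA.
rewrite det_mulmx det_diag dvdp_mulr //.
under eq_bigr do rewrite mxE.
rewrite -big_mkcond prodr_const.
have -> : #|[pred i : 'I_n | (i < r)%N]| = r.
  rewrite -sum1_card -[RHS]card_ord -sum1_card.
  by rewrite (big_ord_widen n (fun _ => 1%N)).
exact: dvdpp.
Qed.

(** A constant invertible matrix, whose first rows span the left kernel of [A] at [c], makes that
    many rows of the product vanish at [c]. *)
Lemma dvdp_det_corank n (A : 'M[{poly F}]_n) c e :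
  (e + \rank (map_mx (horner_eval c) A) <= n)%N -> ('X - c%:P) ^+ e %| \det A.
Proof.
set A0 := map_mx _ A => le_e; pose N := kermx A0; pose E := row_ebase N.
have rN : \rank N = (n - \rank A0)%N by rewrite mxrank_ker.
have EA0 : pid_mx (\rank N) *m E *m A0 = 0 :> 'M_n.
  have : N *m A0 = 0 by apply: mulmx_ker.
  rewrite -{1}[N](mulmx_ebase N) => /(congr1 (mulmx (invmx (col_ebase N)))).
  by rewrite mulmx0 !mulmxA mulVmx ?col_ebase_unit // mul1mx.
have detE : \det (map_mx (@polyC F) E) = (\det E)%:P by rewrite det_map_mx.
have nzE : \det E != 0 by rewrite -unitfE -unitmxE row_ebase_unit.
have : ('X - c%:P) ^+ \rank N %| \det (map_mx polyC E *m A).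
  apply: dvdp_det_rows; last by rewrite rN leq_subr.
  move=> i j lt_i; rewrite dvdp_XsubCl /root.
  have /matrixP/(_ i j) := EA0; rewrite -mulmxA [RHS]mxE mxE.
  rewrite (bigD1 i) //= big1 => [|l ne_l]; last first.
    rewrite [pid_mx _ _ _]mxE; have -> : (i == l :> nat) = false.
      by apply: contraNF ne_l => /eqP/val_inj ->.
    by rewrite mul0r.
  rewrite [pid_mx _ _ _]mxE eqxx lt_i mul1r addr0 => E0; apply/eqP; rewrite -[RHS]E0 !mxE horner_sum.
  by apply: eq_bigr => l _; rewrite !mxE hornerM hornerC.
rewrite det_mulmx detE mul_polyC dvdpZr // => dv.
by apply: dvdp_trans dv; apply: dvdp_exp2l; rewrite rN; lia.
Qed.

End Multiplicity.

Section Rank.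
Variable F : fieldType.
Hypothesis ch2 : 2%N \notin [pchar F].

Lemma rank_sgn_mx p : (\rank (sgn_mx F p) <= 2 * p./2)%N.
Proof.
case: (boolP (odd p)) => op; last first.
  by rewrite mul2n even_halfK // rank_leq_row.
have /eqP d0 := det_skew_odd ch2 (tr_sgn_mx F p) op.
have : (\rank (sgn_mx F p) < p)%N.
  rewrite ltn_neqAle rank_leq_row andbT; apply: contraTN d0 => full.
  by have : row_free (sgn_mx F p) by []; rewrite row_free_unit unitmxE unitfE.
by move: (\rank _) => r; have := odd_double_half p; rewrite op; lia.
Qed.

Lemma sgn_mx_rev q (t s : 'I_q) : sgn_mx F q (rev_ord t) (rev_ord s) = - sgn_mx F q t s.
Proof.
rewrite !mxE opprB /=; have lt_t := ltn_ord t; have lt_s := ltn_ord s.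
have -> : (q - t.+1 < q - s.+1)%N = (s < t)%N by lia.
by have -> : (q - s.+1 < q - t.+1)%N = (t < s)%N by lia.
Qed.

Lemma sgn_form_sym a q (G : 'M[F]_(a, q)) (sg : bool) :
  (forall i s, G i (rev_ord s) = (-1) ^+ sg * G i s) -> G *m sgn_mx F q *m G^T = 0.
Proof.
move=> symG; set B := _ *m _.
suff : B = - B.
  move=> /eqP; rewrite -addr_eq0 -mulr2n -scaler_nat scaler_eq0.
  by move: ch2; rewrite inE /= => /negbTE -> /= /eqP.
have BE i j : B i j = \sum_s \sum_t G i t * sgn_mx F q t s * G j s.
  by rewrite mxE; apply: eq_bigr => s _; rewrite mxE [G^T _ _]mxE mulr_suml.
apply/matrixP => i j; rewrite [RHS]mxE !BE [LHS](reindex_inj rev_ord_inj) /= -sumrN.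
apply: eq_bigr => s _; rewrite [LHS](reindex_inj rev_ord_inj) /= -sumrN.
apply: eq_bigr => t _; rewrite !symG sgn_mx_rev.
have e : (-1) ^+ sg * (-1) ^+ sg = 1 :> F by rewrite -expr2 sqrr_sign.
by move: e; move: ((-1) ^+ sg) => z e; rewrite -[RHS]mul1r -e; ring.
Qed.

(** Between the [q] symmetric points and the others [sgn_mx] is constant, so the symmetric block
    acts only through its row sum [u], as a single point. In the odd case [u] is 0 and even this
    point disappears. *)
Lemma sgn_form_collapse a q t (G : 'M[F]_(a, q + t)) (odd_sym : bool) :
  (forall i (s : 'I_q), G i (lshift t (rev_ord s)) = (-1) ^+ odd_sym * G i (lshift t s)) ->
  (\rank (G *m sgn_mx F (q + t) *m G^T) <= 2 * (t + ~~ odd_sym)./2)%N.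
Proof.
move=> symG; pose G1 := lsubmx G; pose G2 := rsubmx G.
have sym1 i s : G1 i (rev_ord s) = (-1) ^+ odd_sym * G1 i s by rewrite !mxE symG.
have rank_le p (H : 'M[F]_(a, p)) : (\rank (H *m sgn_mx F p *m H^T) <= 2 * p./2)%N.
  by rewrite (leq_trans (mxrankM_maxl _ _)) // (leq_trans (mxrankM_maxr _ _)) // rank_sgn_mx.
pose u : 'cV[F]_a := G1 *m const_mx 1.
have c1 (x : F) p p' : const_mx x = (const_mx 1 : 'cV_p) *m (const_mx x : 'rV_p').
  by apply/matrixP => i j; rewrite !mxE big_ord1 !mxE mul1r.
have formE : G *m sgn_mx F (q + t) *m G^T =
    row_mx u G2 *m sgn_mx F (1 + t) *m (row_mx u G2)^T.
  rewrite -[in LHS](hsubmxK G) !sgn_mx_block !tr_row_mx !mul_row_block !mul_row_col.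
  rewrite -/G1 -/G2 !mulmxDl (sgn_form_sym sym1) add0r.
  have -> : sgn_mx F 1 = 0 by apply/matrixP => i j; rewrite !ord1 !mxE subrr.
  rewrite mulmx0 mul0mx add0r.
  have -> : G1 *m const_mx 1 = u *m const_mx 1 :> 'M_(a, t).
    by rewrite [X in G1 *m X = _]c1 mulmxA.
  have -> : G2 *m const_mx (-1) *m u^T = G2 *m const_mx (-1) *m G1^T.
    by rewrite /u trmx_mul trmx_const mulmxA -(mulmxA G2); congr (_ *m _ *m _);
       apply/matrixP => i j; rewrite !mxE big_ord1 !mxE mulr1.
  by [].
case: odd_sym symG sym1 formE => symG sym1 ->; last by rewrite [(t + _)%N]addnC; apply: rank_le.
have -> : u = 0.
  have : u = - u.
    apply/colP => i; rewrite !mxE [LHS](reindex_inj rev_ord_inj) /= -sumrN.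
    by apply: eq_bigr => s _; rewrite sym1 expr1 !mxE mulN1r mulNr.
  move=> /eqP; rewrite -addr_eq0 -mulr2n -scaler_nat scaler_eq0.
  by move: ch2; rewrite inE /= => /negbTE -> /= /eqP.
rewrite sgn_mx_block tr_row_mx mul_row_block mul_row_col !(mul0mx, trmx0, mulmx0) !add0r.
by rewrite addn0 rank_le.
Qed.

(** A row outside [cls] affects one row and one column of the form, hence raises the rank by at most
    2. *)
Lemma rank_sgn_form a q t (G : 'M[F]_(a, q + t)) (cls : pred 'I_a) (odd_sym : bool) :
  (forall i (s : 'I_q), cls i ->
     G i (lshift t (rev_ord s)) = (-1) ^+ odd_sym * G i (lshift t s)) ->
  (\rank (G *m sgn_mx F (q + t) *m G^T) <=
   2 * #|predC cls| + 2 * (t + ~~ odd_sym)./2)%N.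
Proof.
move=> symG; set A := _ *m _.
pose dg (P : pred 'I_a) : 'M[F]_a := diag_mx (\row_i (P i)%:R).
have rank_dg P : (\rank (dg P) <= #|P|)%N.
  have -> : dg P = \sum_(i | P i) delta_mx i i.
    apply/matrixP => i j; rewrite summxE !mxE.
    case: (boolP (P i)) => Pi.
      rewrite (bigD1 i) //= big1 ?addr0 => [|l /andP[_ ne_l]]; last first.
        by rewrite mxE [i == l]eq_sym (negbTE ne_l).
      by rewrite mxE eqxx [j == i]eq_sym.
    rewrite mul0rn big1 // => l Pl; rewrite !mxE.
    by case: eqP => // e; rewrite e Pl in Pi.
  rewrite -sum1_card; elim/big_rec2: _ => [|i r B _ le_B]; first by rewrite mxrank0.
  by rewrite (leq_trans (mxrank_add _ _)) // mxrank_delta leq_add.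
have AE : A = dg cls *m A *m dg cls + (dg cls *m A *m dg (predC cls) + dg (predC cls) *m A).
  have dgC : dg cls + dg (predC cls) = 1%:M.
    apply/matrixP => i j; rewrite !mxE -mulrnDl /=.
    by case: (cls i); rewrite ?addr0 ?add0r.
  by rewrite addrA -mulmxDr dgC mulmx1 -mulmxDl dgC mul1mx.
rewrite AE (leq_trans (mxrank_add _ _)) // addnC leq_add //.
  rewrite (leq_trans (mxrank_add _ _)) // mul2n -addnn leq_add //.
    by rewrite (leq_trans (mxrankM_maxr _ _)).
  by rewrite (leq_trans (mxrankM_maxl _ _)).
have -> : dg cls *m A *m dg cls =
    (dg cls *m G) *m sgn_mx F (q + t) *m (dg cls *m G)^T.
  by rewrite trmx_mul tr_diag_mx /A !mulmxA.
apply: sgn_form_collapse => i s; rewrite mul_diag_mx !mxE.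
have := symG i s; case: (cls i) => [->//|_]; last by rewrite !mul0r mulr0.
by rewrite !mul1r.
Qed.

End Rank.

(** * The Gram determinant as a polynomial in the centre *)

(** This is [(lev n k i).-1], the degree of [f_i]. *)
Definition expo (n k i : nat) : nat := (i + (i.+1 - (n - k)))%N.

Definition node (N s : nat) : rat := s%:R - (N%:R - 1) / 2.

Definition Fpol (n k N : nat) : 'M[{poly rat}]_(n, N) :=
  \matrix_(i, s) ('X + (node N s)%:P) ^+ expo n k i.

Definition Fval (n k N : nat) (c : rat) : 'M[rat]_(n, N) :=
  \matrix_(i, s) (c + node N s) ^+ expo n k i.

Definition Dpol (n k N : nat) : {poly rat} :=
  \det (Fpol n k N *m K_mx _ N *m (Fpol n k N)^T).

Lemma Fpol_horner n k N c : map_mx (horner_eval c) (Fpol n k N) = Fval n k N c.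
Proof. by apply/matrixP => i s; rewrite !mxE /horner_eval !hornerE. Qed.

Lemma sgn_mx_horner N (c : rat) :
  map_mx (horner_eval c) (sgn_mx {poly rat} N) = sgn_mx rat N.
Proof. by apply/matrixP => t s; rewrite !mxE rmorphB !rmorph_nat. Qed.

Lemma K_mx_horner N (c : rat) : map_mx (horner_eval c) (K_mx {poly rat} N) = K_mx rat N.
Proof.
by rewrite map_mxD sgn_mx_horner map_const_mx /= /horner_eval hornerC.
Qed.

Lemma Dpol_horner n k N c :
  (Dpol n k N).[c] = \det (Fval n k N c *m K_mx rat N *m (Fval n k N c)^T).
Proof.
rewrite -[LHS]/(horner_eval c _) -det_map_mx !map_mxM -map_trmx.
by rewrite Fpol_horner K_mx_horner.
Qed.

Lemma rank_sgn_form_eq (F : fieldType) a N q t (G : 'M[F]_(a, N)) (cls : pred 'I_a)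
    (odd_sym : bool) :
  2%N \notin [pchar F] -> N = (q + t)%N ->
  (forall i (s s' : 'I_N), cls i -> (s + s').+1 = q -> G i s' = (-1) ^+ odd_sym * G i s) ->
  (\rank (G *m sgn_mx F N *m G^T) <= 2 * #|predC cls| + 2 * (t + ~~ odd_sym)./2)%N.
Proof.
move=> ch2 eqN; rewrite eqN in G *; move=> symG.
by apply: rank_sgn_form => // i s ci; apply: symG => //=; have := ltn_ord s; lia.
Qed.

Lemma sgn_form_skew (R : comNzRingType) a N (G : 'M[R]_(a, N)) :
  (G *m sgn_mx R N *m G^T)^T = - (G *m sgn_mx R N *m G^T).
Proof. by rewrite !trmx_mul trmxK tr_sgn_mx mulmxA mulmxN mulNmx. Qed.

Lemma sgn_form_bordered (R : comNzRingType) a N (G : 'M[R]_(a, N)) :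
  let u := G *m const_mx 1 : 'cV_a in
  let H := block_mx G 0 0 1%:M : 'M_(a + 1, N + 1) in
  block_mx (G *m sgn_mx R N *m G^T) u (- u^T) 0 = H *m sgn_mx R (N + 1) *m H^T.
Proof.
rewrite /= sgn_mx_block tr_block_mx !mulmx_block !trmx0 trmx1.
rewrite !(mul0mx, mulmx0, mul1mx, mulmx1, addr0, add0r).
have -> : sgn_mx R 1 = 0 by apply/matrixP => i j; rewrite !ord1 !mxE subrr.
congr block_mx; rewrite trmx_mul trmx_const -mulNmx; congr (_ *m _).
by apply/matrixP => i j; rewrite !mxE.
Qed.

Lemma card_parity r :
  (\sum_(i < r) (odd i == odd r) = r./2 /\ \sum_(i < r) (odd i != odd r) = uphalf r)%N.
Proof.
elim: r => [|r [IH1 IH2]]; first by rewrite !big_ord0.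
rewrite !big_ord_recr /=; split.
  rewrite -IH2 -[RHS]addn0; congr (_ + _)%N; last by case: (odd r).
  by apply: eq_bigr => i _; case: (odd i); case: (odd r).
rewrite -IH1 -[RHS]addn1; congr (_ + _)%N; last by case: (odd r).
by apply: eq_bigr => i _; case: (odd i); case: (odd r).
Qed.

(** With [r = n - k], the exponents of index at least [r] are [r + 1, r + 3, ...], of parity
    opposite to [r]; only indices below [r] can contribute. *)
Lemma card_bad_parity n k : (k <= n)%N ->
  (\sum_(i < n) (odd (expo n k i) == odd (n - k)) <= (n - k)./2)%N.
Proof.
move=> /subnK <-; move: (n - k)%N => r; rewrite addnK -(card_parity r).1.
rewrite big_split_ord /= [X in (_ + X)%N]big1 ?addn0 => [|i _].
  apply: leq_sum => i _; rewrite /expo addnK /=.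
  have -> : (i.+1 - r = 0)%N by apply/eqP; rewrite subn_eq0.
  by rewrite addn0.
have -> : expo (r + k) k (r + i) = (r + i.*2.+1)%N by rewrite /expo; lia.
by rewrite oddD /= odd_double addbT; case: (odd _).
Qed.

(** With the centre at [t / 2] the first [q] of the [q + t] points are symmetric about the
    origin. *)
Lemma Fval_sym n k q t (i : 'I_n) (s s' : 'I_(q + t)) :
  (s + s').+1 = q -> Fval n k (q + t) (t%:R / 2) i s' =
  (-1) ^+ odd (expo n k i) * Fval n k (q + t) (t%:R / 2) i s.
Proof.
move=> eq_q; rewrite !mxE signr_odd -exprMn; congr (_ ^+ _).
have : (q%:R : rat) = (s + s').+1%:R by rewrite eq_q.
rewrite -[(s + s').+1]addn1 !natrD => q_eq.
by rewrite /node natrD q_eq; field.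
Qed.

(* One of the two skew determinants of [det_bordered] has odd size, hence
   vanishes; the rank of the other one at [t / 2] bounds the multiplicity. *)
Lemma Dpol_root n k q t : (k <= n)%N -> (t <= k)%N ->
  ('X - (t%:R / 2)%:P) ^+ (2 * (k.+1 - t)./2) %| Dpol n k (q + t).
Proof.
move=> le_kn le_tk; pose c : rat := t%:R / 2.
have ch2 : 2%N \notin [pchar rat] by rewrite pchar_num.
have ch2p : 2%N \notin [pchar {poly rat}].
  by rewrite inE /= -polyC_natr polyC_eq0.
pose G := Fpol n k (q + t); pose r := (n - k)%N.
pose cls (i : 'I_n) := odd (expo n k i) == ~~ odd r.
have card_cls : (#|predC cls| <= r./2)%N.
  rewrite -sum1_card big_mkcond /=; apply: leq_trans (card_bad_parity le_kn).
  by apply: leq_sum => i _; rewrite inE /= /cls -/r; case: (odd _); case: (odd r).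
pose A := G *m sgn_mx _ (q + t) *m G^T; pose u := G *m const_mx 1 : 'cV_n.
pose B := block_mx A u (- u^T) 0.
have skA : A^T = - A by apply: sgn_form_skew.
have eB : B = _ := sgn_form_bordered G.
have -> : Dpol n k (q + t) = \det A + \det B by rewrite /Dpol mul_K_mx det_bordered.
have hor a (H : 'M[{poly rat}]_(a, q + t)) (G0 : 'M_(a, q + t)) :
    map_mx (horner_eval c) H = G0 ->
    map_mx (horner_eval c) (H *m sgn_mx _ _ *m H^T) = G0 *m sgn_mx rat (q + t) *m G0^T.
  by move=> <-; rewrite !map_mxM -map_trmx sgn_mx_horner.
case: (boolP (odd n)) => on; last first.
  have -> : \det B = 0.
    apply: (det_skew_odd ch2p); last by rewrite addn1 /=.
    by rewrite eB; apply: sgn_form_skew.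
  rewrite addr0.
  apply: dvdp_det_corank; rewrite (hor _ _ _ (Fpol_horner _ _ _ _)).
  have rk := @rank_sgn_form_eq _ _ _ q t (Fval n k (q + t) c) cls (~~ odd r) ch2 erefl.
  apply: leq_trans (leq_add (leqnn _) (rk _)) _.
    by move=> i s s' /eqP <- eq_q; apply: Fval_sym.
  by move: card_cls on; move: #|_| => z; rewrite /r; lia.
have -> : \det A = 0 by apply: (det_skew_odd ch2p).
rewrite add0r eB; apply: dvdp_det_corank.
set H := block_mx _ _ _ _; pose H0 := block_mx (Fval n k (q + t) c) 0 0 1%:M : 'M_(n + 1, q + t + 1).
have -> : map_mx (horner_eval c) (H *m sgn_mx _ _ *m H^T) = H0 *m sgn_mx rat _ *m H0^T.
  rewrite !map_mxM -map_trmx sgn_mx_horner.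
  by rewrite map_block_mx Fpol_horner !map_mx0 map_mx1.
(* Bordering amounts to one more point, counted with the [t] unsymmetric ones. The new row vanishes
   on the symmetric points, so it fits either parity class. *)
pose cls' (i : 'I_(n + 1)) := if split i is inl i' then cls i' else true.
have splitL (i : 'I_n) : split (lshift 1 i) = inl i := unsplitK (inl i).
have splitR (i : 'I_1) : split (rshift n i) = inr i := unsplitK (inr i).
have card_cls' : (#|predC cls'| <= r./2)%N.
  apply: leq_trans card_cls; rewrite -!sum1_card [X in (X <= _)%N]big_mkcond big_split_ord /=.
  rewrite big_ord1 inE /= /cls' splitR /= addn0 [X in (_ <= X)%N]big_mkcond /=.
  by apply: leq_sum => i _; rewrite !inE /= splitL.
have rk := @rank_sgn_form_eq _ _ _ q (t + 1) H0 cls' (~~ odd r) ch2 (esym (addnA _ _ _)).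
apply: leq_trans (leq_add (leqnn _) (rk _)) _; last first.
  by move: card_cls' on; move: #|_| => z; rewrite /r; lia.
move=> i s s'; rewrite /cls'; case: (split_ordP i) => j -> /=; last first.
  move=> _ eq_q; rewrite /H0.
  have lt_s : (s < q + t)%N by lia.
  have lt_s' : (s' < q + t)%N by lia.
  have -> : s = lshift 1 (Ordinal lt_s) by apply: val_inj.
  have -> : s' = lshift 1 (Ordinal lt_s') by apply: val_inj.
  by rewrite !block_mxEdl !mxE mulr0.
move=> /eqP <- eq_q; rewrite /H0.
have lt_s : (s < q + t)%N by lia.
have lt_s' : (s' < q + t)%N by lia.
have -> : s = lshift 1 (Ordinal lt_s) by apply: val_inj.
have -> : s' = lshift 1 (Ordinal lt_s') by apply: val_inj.
by rewrite !block_mxEul; apply: Fval_sym.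
Qed.

(** The Cauchy-Binet expansion before the choices [f] are grouped by their image. *)
Lemma det_mulmx_expand (R : comNzRingType) n E (A : 'M[R]_(n, E)) (B : 'M[R]_(E, n)) :
  \det (A *m B) = \sum_(f : {ffun 'I_n -> 'I_E}) (\prod_i A i (f i)) * \det (rowsub f B).
Proof.
transitivity (\sum_(s : 'S_n) \sum_(f : {ffun 'I_n -> 'I_E})
   (-1) ^+ s * \prod_i (A i (f i) * B (f i) (s i))).
  apply: eq_bigr => s _; rewrite -mulr_sumr; congr (_ * _).
  rewrite -(bigA_distr_bigA (fun i j => A i j * B j (s i))).
  by apply: eq_bigr => i _; rewrite mxE.
rewrite exchange_big; apply: eq_bigr => f _; rewrite mulr_sumr; apply: eq_bigr => s _.
rewrite big_split /= mulrCA; congr (_ * (_ * _)).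
by apply: eq_bigr => i _; rewrite !mxE.
Qed.

Lemma det_rowsub_noninj (R : comNzRingType) n E (f : 'I_n -> 'I_E) (B : 'M[R]_(E, n)) :
  ~~ injectiveb f -> \det (rowsub f B) = 0.
Proof.
move=> /injectivePn[i [j ne_ij eq_f]]; apply: (determinant_alternate ne_ij) => l.
by rewrite !mxE eq_f.
Qed.

(** Each value outside [0, ..., n - 1] is at least [n] and stands in for a missing value that is at
    most [n - 1]. *)
Lemma sum_injective_ge n E (f : 'I_n -> 'I_E) : injective f ->
  (\sum_(i < n) i + (~~ [forall i, (f i < n)%N]) <= \sum_(i < n) f i)%N.
Proof.
move=> f_inj; pose S := [set f i | i in 'I_n].
have cardS : #|S| = n by rewrite card_imset // card_ord.
have -> : (\sum_(i < n) f i = \sum_(x in S) x)%N.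
  by rewrite big_imset //=; apply: in2W.
have [le_nE|lt_En] := leqP n E; last first.
  by have := leq_card f f_inj; rewrite !card_ord leqNgt lt_En.
pose T := [set x : 'I_E | (x < n)%N].
have sumT : (\sum_(i < n) i = \sum_(x in T) x)%N.
  rewrite (big_ord_widen _ (fun i => i) le_nE).
  by apply: eq_bigl => x; rewrite inE.
have cardT : #|T| = n.
  by rewrite -sum1_card -[RHS]card_ord -sum1_card (big_ord_widen _ (fun _ => 1%N) le_nE);
     apply: eq_bigl => x; rewrite inE.
rewrite sumT (big_setID S) [X in (_ <= X)%N](big_setID T) /= setIC -addnA leq_add2l.
have cardD : #|T :\: S| = #|S :\: T|.
  by apply/eqP; rewrite -(eqn_add2l #|T :&: S|) cardsID setIC cardsID cardS cardT.
have le1 : (\sum_(x in T :\: S) x <= \sum_(x in T :\: S) n.-1)%N.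
  by apply: leq_sum => x; rewrite !inE => /andP[_]; case: (n) => //.
have le2 : (\sum_(x in S :\: T) n <= \sum_(x in S :\: T) x)%N.
  by apply: leq_sum => x; rewrite !inE -leqNgt => /andP[].
rewrite !sum_nat_const in le1 le2.
apply: leq_trans le2; rewrite -cardD; apply: leq_trans (leq_add le1 (leqnn _)) _.
case: (boolP [forall i, _]) => [_|/forallPn[i]]; first by rewrite addn0 leq_mul2l leq_pred orbT.
rewrite -leqNgt => le_nf.
have : (0 < #|T :\: S|)%N.
  rewrite cardD card_gt0; apply/set0Pn; exists (f i).
  by rewrite !inE -leqNgt le_nf imset_f.
have n_gt0 : (0 < n)%N by apply: leq_ltn_trans (ltn_ord i).
by move: #|_| => z; case: (n) n_gt0 => // n' _ /=; nia.
Qed.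

(** For [k <= n] this is [k * (k + 1) / 2], the excess of the exponents over
    [0 + 1 + ... + n.-1]. *)
Definition topdeg (n k : nat) : nat := (\sum_(i < n) (i.+1 - (n - k)))%N.

Definition Ymx (n N : nat) : 'M[rat]_(n, N) := \matrix_(l, s) node N s ^+ l.

(** The Gram determinant of the powers [1, x, ..., x ^+ n.-1]; it carries the whole dependence of
    the top coefficient on [N]. *)
Definition Ldet (n N : nat) : rat := \det (Ymx n N *m K_mx rat N *m (Ymx n N)^T).

Definition Bdet (n k : nat) : rat := \det (\matrix_(i < n, l < n) 'C(expo n k i, l)%:R : 'M[rat]_n).

Definition Wmx (n k E : nat) : 'M[{poly rat}]_(n, E) :=
  \matrix_(i, l) ('C(expo n k i, l)%:R *: 'X^(expo n k i - l)).

Lemma Fpol_Wmx n k N E : (forall i : 'I_n, expo n k i < E)%N ->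
  Fpol n k N = Wmx n k E *m map_mx polyC (Ymx E N).
Proof.
move=> lt_E; apply/matrixP => i s; rewrite !mxE exprDn.
rewrite (big_ord_widen E (fun l => 'X^(expo n k i - l) * (node N s)%:P ^+ l *+ 'C(expo n k i, l))) //.
rewrite big_mkcond /=; apply: eq_bigr => l _; rewrite !mxE ltnS.
case: leqP => le_l; last by rewrite bin_small // scale0r mul0r.
by rewrite -polyC_exp -scalerAl scaler_nat.
Qed.

Lemma Wmx_prod n k E (f : 'I_n -> 'I_E) :
  \prod_(i < n) Wmx n k E i (f i) = (\prod_(i < n) 'C(expo n k i, f i)%:R) *:
    'X^(\sum_(i < n) expo n k i - \sum_(i < n) f i).
Proof.
case: (boolP [forall i, (f i <= expo n k i)%N]) => [/forallP le_f|/forallPn[i]].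
  under eq_bigr do rewrite mxE.
  rewrite scaler_prod; congr (_ *: _); rewrite -sumnB // expr_sum.
  by apply: eq_bigr.
rewrite -ltnNge => lt_i.
rewrite (bigD1 i) //= mxE bin_small // scale0r mul0r.
by rewrite (bigD1 i) //= bin_small // mul0r scale0r.
Qed.

Lemma Wmx_coef_neq0 n k E (f : 'I_n -> 'I_E) :
  \prod_(i < n) 'C(expo n k i, f i)%:R != 0 :> rat ->
  (\sum_(i < n) f i <= \sum_(i < n) expo n k i)%N.
Proof.
move=> /prodf_neq0 nz; apply: leq_sum => i _; rewrite leqNgt; apply/negP => lt_i.
by have := nz i isT; rewrite bin_small // eqxx.
Qed.

Lemma sum_expo n k : (\sum_(i < n) expo n k i = \sum_(i < n) i + topdeg n k)%N.
Proof. by rewrite /expo big_split. Qed.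

Lemma det_Wmx_square n k : \det (Wmx n k n) = Bdet n k *: 'X^(topdeg n k).
Proof.
rewrite /Bdet /determinant scaler_suml; apply: eq_bigr => s _.
rewrite (Wmx_prod k (fun i => s i)) sum_expo.
have -> : (\sum_(i < n) s i = \sum_(i < n) i)%N by rewrite [RHS](reindex_inj (@perm_inj _ s)).
rewrite addKn -scalerAr -[(-1) ^+ s in LHS]mulr1 -[in LHS]signr_odd.
under [in RHS]eq_bigr do rewrite mxE.
rewrite mulr1 signr_odd -[RHS]scalerA; case: (odd_perm s); rewrite ?expr0 ?expr1.
  by rewrite mulN1r scaleN1r scalerN.
by rewrite mul1r scale1r.
Qed.

(* Multilinear expansion in powers of the nodes: distinct exponents sum to at
   least [0 + 1 + ... + n.-1], with equality only for the exponents below [n]. *)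
Lemma Dpol_top n k N : (k <= n)%N ->
  (size (Dpol n k N - (Ldet n N * Bdet n k ^+ 2) *: 'X^(2 * topdeg n k))%R
   <= 2 * topdeg n k)%N.
Proof.
move=> le_kn; pose E := (n + n.+1)%N.
have lt_E (i : 'I_n) : (expo n k i < E)%N by rewrite /expo /E; have := ltn_ord i; lia.
pose W := Wmx n k E; pose Q := Ymx E N *m K_mx rat N *m (Ymx E N)^T.
pose q (f g : {ffun 'I_n -> 'I_E}) := \det (rowsub g (rowsub f Q)^T).
have expand (A : 'M[{poly rat}]_(n, E)) :
   \det (A *m map_mx polyC Q *m A^T) =
   \sum_(f : {ffun 'I_n -> 'I_E}) \sum_(g : {ffun 'I_n -> 'I_E}) ((\prod_i A i (f i)) * (\prod_i A i (g i))) * (q f g)%:P.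
  rewrite -mulmxA det_mulmx_expand; apply: eq_bigr => f _.
  rewrite -mul_rowsub_mx -det_tr trmx_mul trmxK det_mulmx_expand mulr_sumr.
  apply: eq_bigr => g _; rewrite mulrA; congr (_ * _).
  rewrite /q -det_map_mx; congr (\det _); apply/matrixP => i j.
  by rewrite !mxE.
have DE : Dpol n k N = \det (W *m map_mx polyC Q *m W^T).
  rewrite /Dpol (Fpol_Wmx N lt_E) trmx_mul !mulmxA; congr (\det _).
  rewrite /Q !map_mxM map_trmx !mulmxA; congr (_ *m _ *m _ *m _ *m _).
  apply/matrixP => t s; rewrite !mxE rmorphD rmorphB /= !rmorph_nat.
  by rewrite rmorph1.
(* Truncating to the first [n] columns retains exactly the choices [f] and [g] that take all their
   values below [n]. *)
pose W' : 'M[{poly rat}]_(n, E) := row_mx (Wmx n k n) 0.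
have D'E : \det (W' *m map_mx polyC Q *m W'^T) = (Ldet n N * Bdet n k ^+ 2) *: 'X^(2 * topdeg n k).
  rewrite -[Q]submxK map_block_mx tr_row_mx mul_row_block mul_row_col.
  rewrite !(mul0mx, trmx0, mulmx0) !addr0 !det_mulmx det_tr det_Wmx_square det_map_mx.
  have -> : \det (ulsubmx Q) = Ldet n N.
    congr (\det _); apply/matrixP => i j; rewrite !mxE; apply: eq_bigr => s _.
    by rewrite !mxE; congr (_ * _); apply: eq_bigr => t _; rewrite !mxE.
  by rewrite -!mul_polyC polyCM polyC_exp mul2n -addnn exprD; ring.
rewrite -D'E DE !expand -sumrB.
apply: leq_trans (size_sum _ _ _) _; apply/bigmax_leqP => f _; rewrite -sumrB.
apply: leq_trans (size_sum _ _ _) _; apply/bigmax_leqP => g _; rewrite -mulrBl.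
case: (boolP (injectiveb f)) => [/injectiveP f_inj|f_ninj]; last first.
  have -> : q f g = 0.
    have -> : q f g = \det (rowsub f (rowsub g Q^T)^T).
      by rewrite /q -det_tr; congr (\det _); apply/matrixP => i j; rewrite !mxE.
    exact: det_rowsub_noninj.
  by rewrite mulr0 size_poly0.
case: (boolP (injectiveb g)) => [/injectiveP g_inj|g_ninj]; last first.
  by rewrite /q det_rowsub_noninj // mulr0 size_poly0.
have W'0 (h : {ffun 'I_n -> 'I_E}) :
    \prod_i W' i (h i) = if [forall i, (h i < n)%N] then \prod_i W i (h i) else 0.
  case: ifP => [/forallP lt_h|/negbT/forallPn[i ge_i]].
    apply: eq_bigr => i _; have -> : h i = lshift n.+1 (Ordinal (lt_h i)) by apply: val_inj.
    by rewrite row_mxEl !mxE.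
  rewrite (bigD1 i) //=; rewrite -leqNgt in ge_i.
  have lt_i : (h i - n < n.+1)%N by have := ltn_ord (h i); rewrite /E; lia.
  have -> : h i = rshift n (Ordinal lt_i) by apply: val_inj; rewrite /= subnKC.
  by rewrite row_mxEr mxE mul0r.
rewrite !W'0.
have bound : ~~ ([forall i, (f i < n)%N] && [forall i, (g i < n)%N]) ->
   (size ((\prod_i W i (f i)) * (\prod_i W i (g i)) * (q f g)%:P)%R <= 2 * topdeg n k)%N.
  move=> nsmall; rewrite mulrC mul_polyC; apply: leq_trans (size_scale_leq _ _) _.
  rewrite !Wmx_prod -scalerAl -scalerAr scalerA.
  have [->|nzf] := eqVneq (\prod_(i < n) 'C(expo n k i, f i)%:R : rat) 0.
    by rewrite mul0r scale0r size_poly0.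
  have [->|nzg] := eqVneq (\prod_(i < n) 'C(expo n k i, g i)%:R : rat) 0.
    by rewrite mulr0 scale0r size_poly0.
  apply: leq_trans (size_scale_leq _ _) _; rewrite -exprD size_polyXn.
  have := sum_injective_ge f_inj; have := sum_injective_ge g_inj.
  have := Wmx_coef_neq0 nzf; have := Wmx_coef_neq0 nzg; rewrite sum_expo.
  move: nsmall; move: [forall i, _] [forall i, _] => bf bg.
  move: (\sum_(i < n) f i)%N (\sum_(i < n) g i)%N (\sum_(i < n) i)%N (topdeg n k) => a b c d.
  by case: bf; case: bg => //=; lia.
case: (boolP [forall i, (f i < n)%N]) bound => fs; case: (boolP [forall i, (g i < n)%N]) => gs bound.
- by rewrite subrr mul0r size_poly0.
- by rewrite mulr0 subr0 bound.
- by rewrite mul0r subr0 bound.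
- by rewrite mul0r subr0 bound.
Qed.

(** * The roots of the Gram determinant *)

Definition pairs (k : nat) : {set 'I_k * 'I_k} := [set p : 'I_k * 'I_k | (p.1 <= p.2)%N].

(** Indexing the roots by pairs [i <= j] lists each with half its multiplicity, and matches the
    double products of the theorem. *)
Definition Zroot (k : nat) (p : 'I_k * 'I_k) : rat := (k%:R - 1 - p.1%:R - p.2%:R) / 2.

Definition Zpol (k : nat) : {poly rat} := \prod_(p in pairs k) ('X - (Zroot p)%:P) ^+ 2.

Lemma dvdp_prod_XsubC_exp (F : fieldType) (I : eqType) (s : seq I) (z : I -> F) (e : I -> nat)
    (D : {poly F}) : uniq s -> {in s &, injective z} ->
  (forall i, i \in s -> ('X - (z i)%:P) ^+ e i %| D) ->
  \prod_(i <- s) ('X - (z i)%:P) ^+ e i %| D.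
Proof.
elim: s => [|i s IH] /=; first by rewrite big_nil dvd1p.
move=> /andP[i_s us] z_inj dvD; rewrite big_cons Gauss_dvdp.
  rewrite dvD ?mem_head // IH // => [j l js ls|j js].
    by apply: z_inj; rewrite inE ?js ?ls orbT.
  by apply: dvD; rewrite inE js orbT.
rewrite coprimep_expl // big_seq; elim/big_rec: _ => [|j q js cop]; first exact: coprimep1.
rewrite coprimepMr cop andbT coprimep_expr // coprimep_XsubC root_XsubC.
apply: contraNneq i_s => eq_z; rewrite -(_ : j = i) //.
by apply: z_inj; rewrite // inE ?eqxx ?js ?orbT.
Qed.

Lemma card_le_inj (T : finType) (A : {set T}) (f : T -> nat) b :
  {in A &, injective f} -> (forall x, x \in A -> (f x < b)%N) -> (#|A| <= b)%N.
Proof.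
move=> f_inj lt_b; rewrite cardE -(size_map f) -(size_iota 0 b).
apply: uniq_leq_size => [|y /mapP[x]].
  by rewrite map_inj_in_uniq ?enum_uniq // => x y; rewrite !mem_enum; apply: f_inj.
by rewrite mem_enum => /lt_b lt_x ->; rewrite mem_iota.
Qed.

(** For [u] up to [k.-1] the smaller entry determines the pair and is at most [u / 2]; for larger
    [u] the distance of the larger entry from [k.-1] plays the same part. *)
Lemma card_level k u t : (u + t = k.-1 \/ u = k.-1 + t)%N ->
  (#|[set p in pairs k | (p.1 + p.2 == u)%N]| <= (k.+1 - t)./2)%N.
Proof.
move=> ut; pose A := [set p in pairs k | (p.1 + p.2 == u)%N].
have AP p : p \in A -> (p.1 <= p.2)%N /\ (p.1 + p.2 = u)%N.
  by rewrite !inE => /andP[? /eqP].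
have inj1 : {in A &, injective (fun p : 'I_k * 'I_k => nat_of_ord p.1)}.
  move=> [i j] [i' j'] /AP /= [_ e] /AP /= [_ e'] eq_i.
  by congr (_, _); apply/val_inj => //=; lia.
have inj2 : {in A &, injective (fun p : 'I_k * 'I_k => k.-1 - p.2)%N}.
  move=> [i j] [i' j'] /AP /= [_ e] /AP /= [_ e'] eq_j.
  have := ltn_ord j; have := ltn_ord j' => ? ?.
  by congr (_, _); apply/val_inj => //=; lia.
case: ut => ut.
  by apply: card_le_inj inj1 _ => -[i j] /AP /= [le_ij e]; have := ltn_ord i; lia.
apply: card_le_inj inj2 _ => -[i j] /AP /= [le_ij e].
by have := ltn_ord i; have := ltn_ord j; lia.
Qed.

Lemma dvd_Zpol k (D : {poly rat}) :
  (forall t, (t < k)%N -> ('X - (t%:R / 2)%:P) ^+ (2 * (k.+1 - t)./2) %| D) ->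
  (forall t, (t < k)%N -> ('X - (- (t%:R / 2))%:P) ^+ (2 * (k.+1 - t)./2) %| D) ->
  Zpol k %| D.
Proof.
move=> dvp dvn; case: k => [|k] in dvp dvn *.
  by rewrite /Zpol big1 ?dvd1p // => -[[]].
pose lvl (p : 'I_k.+1 * 'I_k.+1) : 'I_(2 * k).+1 := inord (p.1 + p.2).
have lvlE p : lvl p = (p.1 + p.2)%N :> nat.
  by rewrite /lvl inordK //; have := ltn_ord p.1; have := ltn_ord p.2; lia.
pose z (u : 'I_(2 * k).+1) : rat := (k%:R - u%:R) / 2.
(* Grouping the pairs by [u = i + j] makes the roots distinct, hence the factors coprime. *)
have -> : Zpol k.+1 =
  \prod_(u <- enum 'I_(2 * k).+1) ('X - (z u)%:P) ^+
     (2 * #|[set p in pairs k.+1 | (p.1 + p.2 == u)%N]|).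
  rewrite /Zpol (partition_big lvl predT) //= big_enum /=; apply: eq_bigr => u _.
  rewrite exprM -prodr_const; apply: eq_big => [p|p].
    by rewrite !inE -val_eqE /= lvlE.
  move=> /andP[_ /eqP <-]; congr (('X - _%:P) ^+ 2).
  by rewrite /z /Zroot lvlE natrD -[k.+1%:R]natr1; congr (_ / 2); ring.
apply: dvdp_prod_XsubC_exp.
- exact: enum_uniq.
- move=> u v _ _ /eqP; rewrite /z (inj_eq (mulIf _)) ?invr_eq0 //.
  by rewrite (inj_eq (addrI _)) (inj_eq oppr_inj) eqr_nat => /eqP/val_inj.
- move=> u _; have lt_u := ltn_ord u; case: (leqP u k) => le_uk.
    have zE : (k - u)%N%:R / 2 = z u by rewrite natrB.
    have lt_k : (k - u < k.+1)%N by lia.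
    have := dvp _ lt_k; rewrite zE; apply: dvdp_trans.
    by rewrite dvdp_exp2l // leq_mul2l /= card_level //; left; lia.
  have zE : - ((u - k)%N%:R / 2) = z u by rewrite natrB ?(ltnW le_uk) // /z -mulNr opprB.
  have lt_k : (u - k < k.+1)%N by lia.
  have := dvn _ lt_k; rewrite zE; apply: dvdp_trans.
  by rewrite dvdp_exp2l // leq_mul2l /= card_level //; right; lia.
Qed.

Lemma Zpol_sqr k : Zpol k = (\prod_(p <- enum (pairs k)) ('X - (Zroot p)%:P)) ^+ 2.
Proof. by rewrite /Zpol -prodrXl big_enum. Qed.

Lemma Zpol_monic k : Zpol k \is monic.
Proof. by rewrite Zpol_sqr monic_exp // monic_prod_XsubC. Qed.

Lemma size_Zpol k : size (Zpol k) = (2 * #|pairs k|).+1.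
Proof.
rewrite Zpol_sqr expr2 size_Mmonic ?monic_neq0 ?monic_prod_XsubC //.
by rewrite !size_prod_XsubC -cardE; lia.
Qed.

(** * Binomial functions as polynomials in the centred variable *)

Lemma ffact_natr (R : pzRingType) (u e : nat) : (u ^_ e)%:R = \prod_(j < e) (u%:R - j%:R) :> R.
Proof.
elim: e => [|e IH]; first by rewrite big_ord0 ffactn0.
rewrite big_ord_recr /= -IH ffactnSr natrM; case: (leqP e u) => le_eu; first by rewrite natrB.
by rewrite ffact_small // !mul0r.
Qed.

(** The function ['C(s + q, e)] as a polynomial in [x = s + 1 - r / 2]; for [r + 2 * q = e.+1] its
    roots are symmetric about 0. *)
Definition bpoly (r q e : nat) : {poly rat} :=
  (e`!%:R)^-1 *: \prod_(j < e) ('X - (1 - r%:R / 2 + j%:R - q%:R)%:P).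

Lemma bpoly_horner r q e (s : nat) :
  (bpoly r q e).[s%:R + 1 - r%:R / 2] = 'C(s + q, e)%:R.
Proof.
rewrite hornerZ horner_prod.
have -> : 'C(s + q, e)%:R = (e`!%:R)^-1 * ((s + q) ^_ e)%:R :> rat.
  by rewrite -bin_ffact natrM mulrCA mulVf ?mulr1 // pnatr_eq0 -lt0n fact_gt0.
rewrite ffact_natr; congr (_ * _); apply: eq_bigr => j _.
by rewrite !hornerE natrD; ring.
Qed.

Lemma size_bpoly r q e : (size (bpoly r q e) <= e.+1)%N.
Proof.
apply: leq_trans (size_scale_leq _ _) _.
by rewrite size_prod_XsubC /index_enum -enumT -cardE card_ord.
Qed.

Lemma coef_comp_oppX (R : comNzRingType) (p : {poly R}) j : (p \Po - 'X)`_j = (-1) ^+ j * p`_j.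
Proof.
rewrite comp_polyE coef_sum.
transitivity (\sum_(i < size p) if i == j :> nat then (-1) ^+ j * p`_j else 0).
  apply: eq_bigr => i _; rewrite -scaleN1r exprZn !coefZ coefXn [j == _]eq_sym.
  by case: eqP => [->|_]; rewrite ?mulr1 ?mulr0 // mulrC.
rewrite -big_mkcond /=; case: (ltnP j (size p)) => lt_j.
  by rewrite (big_pred1 (Ordinal lt_j)).
rewrite big_pred0 ?nth_default ?mulr0 // => i; apply/negP => /eqP eq_ij.
by have := ltn_ord i; rewrite eq_ij ltnNge lt_j.
Qed.

Lemma comp_poly_prod (R : comNzRingType) (I : finType) (F : I -> {poly R}) (q : {poly R}) :
  (\prod_i F i) \Po q = \prod_i (F i \Po q).
Proof.
elim/big_ind2: _ => [|p1 q1 p2 q2 <- <-|//]; last by rewrite comp_polyM.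
exact: (comp_polyC 1 q).
Qed.

Lemma bpoly_parity r q e j : (r + 2 * q = e.+1)%N -> odd j != odd e -> (bpoly r q e)`_j = 0.
Proof.
move=> e_rq par; have : bpoly r q e \Po - 'X = (-1) ^+ e *: bpoly r q e.
  rewrite /bpoly comp_polyZ; set c := _^-1; set p := \prod_(_ < _) _.
  rewrite (_ : (-1) ^+ e *: (c *: p) = c *: ((-1) ^+ e *: p)); last by rewrite !scalerA mulrC.
  congr (_ *: _); rewrite /p comp_poly_prod [LHS](reindex_inj rev_ord_inj) /=.
  rewrite -[e in (-1) ^+ e]card_ord -prodr_const -scaler_prod; apply: eq_bigr => i _.
  rewrite comp_polyB comp_polyX comp_polyC scaleN1r opprB addrC -polyCN.
  congr (_%:P - 'X); rewrite natrB //.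
  have : (r%:R + 2 * q%:R : rat) = e%:R + 1 by rewrite -natrM -natrD e_rq -addn1 natrD.
  have -> : (i.+1%:R : rat) = i%:R + 1 by rewrite -addn1 natrD.
  by move=> h; rewrite (_ : e%:R = r%:R + 2 * q%:R - 1); [field | rewrite h addrK].
move: (bpoly r q e) => p /(congr1 (fun p : {poly rat} => p`_j)).
rewrite coef_comp_oppX coefZ.
rewrite -(signr_odd _ j) -(signr_odd _ e).
have -> : odd e = ~~ odd j by move: par; case: (odd j); case: (odd e).
by case: (odd j) => /=; rewrite expr0 expr1 mul1r mulN1r => h; lra.
Qed.

Lemma bpoly_expand n k (i : 'I_n) (x : rat) : (k <= n)%N ->
  (bpoly (n - k) (expo n k i - i) (expo n k i)).[x] =
  \sum_(l < n) (bpoly (n - k) (expo n k i - i) (expo n k i))`_(expo n k l) * x ^+ expo n k l.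
Proof.
move=> le_kn; set p := bpoly _ _ _; pose E := (2 * n).+1.
have lt_E (l : 'I_n) : (expo n k l < E)%N by rewrite /expo /E; have := ltn_ord l; lia.
have size_p : (size p <= E)%N by apply: leq_trans (size_bpoly _ _ _) (lt_E i).
rewrite (horner_coef_wide _ size_p).
pose h (l : 'I_n) : 'I_E := Ordinal (lt_E l).
have h_inj : injective h.
  move=> a b /(congr1 val) /=; rewrite /expo => e; apply: val_inj; move: e => /=.
  lia.
rewrite (bigID (mem [set h l | l in 'I_n])) /= [X in _ + X]big1 ?addr0 => [|j].
  by rewrite big_imset /= => [|a b _ _]; [|exact: h_inj].
move=> jim; suff -> : p`_j = 0 by rewrite mul0r.
have notj (l : 'I_n) : expo n k l != j.
  by apply: contraNneq jim => e; apply/imsetP; exists l => //; apply: val_inj.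
have le_rj : (n - k <= j)%N.
  rewrite leqNgt; apply/negP => lt_jr; have lt_jn : (j < n)%N by lia.
  by have := notj (Ordinal lt_jn); rewrite /expo /=; lia.
case: (leqP (expo n k i).+1 j) => [le_ej|lt_je].
  by rewrite nth_default // (leq_trans (size_bpoly _ _ _)).
have le_ri : (n - k <= i)%N by move: lt_je; rewrite /expo; have := ltn_ord i; lia.
apply: bpoly_parity; first by rewrite /expo; lia.
apply/negP => /eqP par.
(* This is the index [l] with [expo n k l = j], from [2 * l + 1 = j + (n - k)]. *)
have lt_ln : ((j + (n - k))./2 < n)%N by move: lt_je par; rewrite /expo; have := ltn_ord i; lia.
by have := notj (Ordinal lt_ln); rewrite /expo /=; move: lt_je par; rewrite /expo; lia.
Qed.

Lemma comp_poly_exp (R : comNzRingType) (p q : {poly R}) e : p ^+ e \Po q = (p \Po q) ^+ e.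
Proof.
elim: e => [|e IH]; first by rewrite !expr0; apply: (comp_polyC 1 q).
by rewrite !exprS comp_polyM IH.
Qed.

(** Changing the sign of the centre reverses the points up to the signs [(-1) ^+ expo n k i], which
    enter squared, and transposes [K_mx]. *)
Lemma Dpol_comp_opp n k N : Dpol n k N \Po - 'X = Dpol n k N.
Proof.
pose F := Fpol n k N; pose e (i : 'I_n) : {poly rat} := (-1) ^+ expo n k i.
have formE (G : 'M[{poly rat}]_(n, N)) i j :
    (G *m K_mx _ N *m G^T) i j = \sum_s \sum_t G i t * K_mx _ N t s * G j s.
  by rewrite mxE; apply: eq_bigr => s _; rewrite mxE [G^T _ _]mxE mulr_suml.
pose F' := map_mx (fun p : {poly rat} => p \Po - 'X) F.
have F'E i s : F' i s = e i * F i (rev_ord s).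
  rewrite !mxE /e -exprMn comp_poly_exp comp_polyD comp_polyX comp_polyC; congr (_ ^+ _).
  rewrite mulN1r opprD -polyCN; congr (_ + _%:P); rewrite /node /= natrB // -natr1.
  by field.
have K_rev t s : K_mx {poly rat} N (rev_ord t) (rev_ord s) = K_mx _ N s t.
  rewrite !K_mxE /=; have := ltn_ord t; have := ltn_ord s => lt_s lt_t.
  have -> : (N - t.+1 < N - s.+1)%N = (s < t)%N by lia.
  by have -> : (N - t.+1 == N - s.+1)%N = (s == t :> nat) by lia.
have -> : Dpol n k N \Po - 'X = \det (F' *m K_mx _ N *m F'^T).
  rewrite -[LHS]/(comp_poly (- 'X) _) /Dpol -det_map_mx !map_mxM /F' map_trmx.
  congr (\det (_ *m _ *m _)); apply/matrixP => t s; rewrite mxE !K_mxE.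
  by case: ifP => _; rewrite /= rmorph_nat.
have -> : F' *m K_mx _ N *m F'^T =
   diag_mx (\row_i e i) *m (F *m K_mx _ N *m F^T)^T *m diag_mx (\row_i e i).
  have dE (A : 'M[{poly rat}]_n) i j :
      (diag_mx (\row_i e i) *m A *m diag_mx (\row_i e i)) i j = e i * A i j * e j.
    by rewrite mul_mx_diag mul_diag_mx !mxE.
  apply/matrixP => i j; rewrite formE dE [_^T _ _]mxE formE.
  rewrite [LHS](reindex_inj rev_ord_inj) exchange_big /= mulr_sumr mulr_suml.
  rewrite [LHS](reindex_inj rev_ord_inj) /=.
  apply: eq_bigr => t _; rewrite mulr_sumr mulr_suml; apply: eq_bigr => s _.
  by rewrite !F'E !rev_ordK K_rev; ring.
rewrite !det_mulmx det_tr det_diag mulrAC -expr2 -prodrXl big1 ?mul1r // => i _.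
by rewrite mxE /e -exprM mulnC exprM sqrrN !expr1n.
Qed.

Lemma card_pairs n k : (k <= n)%N -> #|pairs k| = topdeg n k.
Proof.
move=> /subnK <-; move: (n - k)%N => r; rewrite /topdeg addnK big_split_ord /=.
rewrite big1 ?add0n => [|i _]; last by apply/eqP; rewrite subn_eq0.
rewrite -sum1_card (eq_bigl (fun p : 'I_k * 'I_k => (p.1 <= p.2)%N)) => [|p]; last by rewrite inE.
rewrite -(pair_big_dep xpredT (fun i j : 'I_k => (i <= j)%N) (fun _ _ => 1%N)) /=.
rewrite (exchange_big_dep xpredT) //=; apply: eq_bigr => j _.
rewrite -addnS addKn -[RHS]card_ord -sum1_card (big_ord_widen k (fun _ => 1%N)) //.
Qed.

(** The roots [t / 2] come from [Dpol_root] and their opposites from evenness, so [Zpol k] divides.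
    Its degree equals the bound on that of [Dpol], so the quotient is the top coefficient. *)
Lemma DpolE n k N : (k <= n)%N -> (k <= N)%N ->
  Dpol n k N = (Ldet n N * Bdet n k ^+ 2) *: Zpol k.
Proof.
move=> le_kn le_kN; set D := Dpol n k N; set c := _ * _.
have dvp t : (t < k)%N -> ('X - (t%:R / 2)%:P) ^+ (2 * (k.+1 - t)./2) %| D.
  move=> lt_tk; have le_tN : (t <= N)%N by apply: leq_trans (ltnW lt_tk) le_kN.
  by rewrite /D -(subnK le_tN) Dpol_root // ltnW.
have /dvdpP[q Dq] : Zpol k %| D.
  apply: dvd_Zpol => // t /dvp dv; have := dvdp_comp_poly (- 'X) dv.
  rewrite /D Dpol_comp_opp -/D; apply: dvdp_trans.
  rewrite comp_poly_exp comp_polyB comp_polyX comp_polyC polyCN opprK.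
  by rewrite -opprD exprNn dvdp_mulIr.
have top := Dpol_top N le_kn; rewrite -/D -/c in top.
have sizeZ : size (Zpol k) = (2 * topdeg n k).+1 by rewrite size_Zpol (card_pairs le_kn).
have coefD : D`_(2 * topdeg n k) = c.
  have /(nth_default 0) := top; rewrite coefB coefZ coefXn eqxx mulr1.
  by move/eqP; rewrite subr_eq0 => /eqP.
have sizeD : (size D <= (2 * topdeg n k).+1)%N.
  rewrite -[D](subrK (c *: 'X^(2 * topdeg n k))); apply: leq_trans (size_polyD _ _) _.
  rewrite geq_max (leq_trans top) //= (leq_trans (size_scale_leq _ _)) //.
  by rewrite size_polyXn.
have sq : (size q <= 1)%N.
  have [->|nz_q] := eqVneq q 0; first by rewrite size_poly0.
  have := sizeD; rewrite Dq size_Mmonic ?Zpol_monic // sizeZ.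
  by move: (size q) (2 * topdeg n k)%N => x y; lia.
have qE : q = (q`_0)%:P by apply: size1_polyC.
have : c = q`_0.
  rewrite -coefD Dq qE coefCM coefC /= -[RHS]mulr1; congr (_ * _).
  by have /eqP := Zpol_monic k; rewrite lead_coefE sizeZ.
by move=> ->; rewrite Dq {1}qE mul_polyC.
Qed.

Definition tprod (k : nat) (x : rat) : rat :=
  \prod_(p in pairs k) ((x + (p.1 + p.2).+2%:R) / 2).

Lemma Zpol_horner k x : (Zpol k).[(x + k%:R + 1) / 2] = tprod k x ^+ 2.
Proof.
rewrite /Zpol horner_prod -prodrXl; apply: eq_bigr => p _.
rewrite horner_exp hornerXsubC; congr (_ ^+ 2); rewrite /Zroot.
have -> : (p.1 + p.2).+2%:R = p.1%:R + p.2%:R + 2 :> rat by rewrite -addn2 !natrD.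
by field.
Qed.

Lemma tprod_neq0 k x : - 2 < x -> tprod k x != 0.
Proof.
move=> x_gt; apply/prodf_neq0 => p _; rewrite mulf_neq0 ?invr_eq0 // lt0r_neq0 //.
rewrite -[(p.1 + p.2).+2]addn2 natrD addrCA ltr_wpDl ?ler0n //.
by rewrite -ltrBlDr sub0r.
Qed.

Lemma Dpol_eval n k N x : (k <= n)%N -> (k <= N)%N ->
  (Dpol n k N).[(x + k%:R + 1) / 2] = Ldet n N * Bdet n k ^+ 2 * tprod k x ^+ 2.
Proof. by move=> le_kn le_kN; rewrite DpolE // hornerZ Zpol_horner. Qed.

Lemma form_K_row0 n N (F : 'M[rat]_(n, N)) :
  let F0 := row_mx (0 : 'cV_n) F in
  F0 *m K_mx rat (1 + N) *m F0^T = F *m K_mx rat N *m F^T.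
Proof.
have -> : K_mx rat (1 + N) = block_mx (K_mx rat 1) (const_mx 2) 0 (K_mx rat N).
  have c1 : const_mx 1 = block_mx (const_mx 1) (const_mx 1) (const_mx 1) (const_mx 1)
      :> 'M[rat]_(1 + N) by rewrite block_mx_const.
  rewrite /K_mx sgn_mx_block c1 add_block_mx.
  by congr block_mx; apply/matrixP => i j; rewrite !mxE ?addNr.
by rewrite /= tr_row_mx mul_row_block mul_row_col !(mul0mx, trmx0, mulmx0) !add0r.
Qed.

(** With [N.+1] points centred at [N / 2] the first one is the origin, where all the functions
    vanish; dropping it leaves [N] points centred at [(N + 1) / 2]. *)
Lemma Dpol_shift n N : (Dpol n n N.+1).[N%:R / 2] = (Dpol n n N).[(N%:R + 1) / 2].
Proof.
rewrite !Dpol_horner -[in RHS]form_K_row0 /=; pose F := Fval n n N ((N%:R + 1) / 2).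
suff -> : Fval n n N.+1 (N%:R / 2) = row_mx (0 : 'cV_n) F :> 'M_(n, 1 + N) by [].
apply/matrixP => i s; rewrite -[s]splitK; case: (split s) => s' /=.
  rewrite row_mxEl !mxE ord1 /node; set x := _ + _.
  have -> : x = 0 by rewrite /x /= -natr1; field.
  by rewrite expr0n /expo addn_eq0 subnn andbF.
by rewrite row_mxEr !mxE; congr (_ ^+ _); rewrite /node /= add1n -!natr1; field.
Qed.

(** * Evaluation *)

Section Evaluation.
Variables (n k : nat).
Hypothesis le_kn : (k <= n)%N.

Definition Fmat (N : nat) : 'M[rat]_(n, N) := \matrix_(i, s) fcol (lev n k) i 0 s.

Definition Hdet (N : nat) : rat := \det (Fmat N *m K_mx rat N *m (Fmat N)^T).

Lemma Hdet_gcol N :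
  \det (\matrix_(i < n, j < n) \sum_(s < N) gcol (lev n k) i 0 s * fcol (lev n k) j 0 s) = Hdet N.
Proof.
congr (\det _); apply/matrixP => i j; rewrite !mxE; apply: eq_bigr => s _.
rewrite [(Fmat N)^T _ _]mxE [Fmat N j s]mxE; congr (_ * _).
rewrite (gcol0E _ _ (ltn_ord i)) mxE.
transitivity (\sum_(t < N) (if (t < s)%N then 2 * fcol (lev n k) i 0 t else 0) +
              \sum_(t < N) (if t == s then fcol (lev n k) i 0 t else 0)).
  rewrite addrC; congr (_ + _); last by rewrite -big_mkcond big_pred1_eq.
  rewrite -big_mkcond mulr_sumr.
  by rewrite (big_ord_widen N (fun t => 2 * fcol (lev n k) i 0 t)) // ltnW.
rewrite -big_split; apply: eq_bigr => t _ /=; rewrite K_mxE [Fmat N i t]mxE.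
case: ltngtP => [lt_ts|gt_ts|/val_inj ->].
- by rewrite -val_eqE ltn_eqF // addr0 mulrC.
- by rewrite -val_eqE gtn_eqF // addr0 mulr0.
- by rewrite eqxx add0r mulr1.
Qed.

Lemma Hdet_base : Hdet n = 1.
Proof.
rewrite /Hdet !det_mulmx det_tr det_K_mx mulr1.
have -> : \det (Fmat n) = 1; last by rewrite mulr1.
rewrite -det_tr det_trig.
  rewrite big1 // => i _; rewrite !mxE.
  by apply: fcol_diag => //; exact: lev_incr.
apply/is_trig_mxP => i j lt_ij; rewrite !mxE.
by apply: fcol_small => //; exact: lev_incr.
Qed.

(** The change of basis from binomial functions to powers does not involve [m], and the centre
    [(m + k + 1) / 2] places the point [s] at [s + 1 - (n - k) / 2]. *)
Lemma Hdet_Dpol : exists a : rat, forall m : nat,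
  Hdet (n + m) = a * (Dpol n k (n + m)).[(m%:R + k%:R + 1) / 2].
Proof.
pose b (i : 'I_n) := bpoly (n - k) (expo n k i - i) (expo n k i).
pose Pm : 'M[rat]_n := \matrix_(i, j) (b i)`_(expo n k j).
exists (\det Pm ^+ 2) => m; rewrite Dpol_horner.
have FE : Fmat (n + m) = Pm *m Fval n k (n + m) ((m%:R + k%:R + 1) / 2).
  apply/matrixP => i s; rewrite mxE (fcol0E _ _ (ltn_ord i)) -[(lev n k i).-1]/(expo n k i).
  rewrite -(bpoly_horner (n - k)) bpoly_expand // mxE; apply: eq_bigr => l _.
  rewrite !mxE; congr (_ * _).
  by congr (_ ^+ _); rewrite /node natrB // natrD; field.
rewrite /Hdet FE; set F := Fval _ _ _ _.
have -> : Pm *m F *m K_mx rat (n + m) *m (Pm *m F)^T = Pm *m (F *m K_mx rat (n + m) *m F^T) *m Pm^T.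
  by rewrite trmx_mul !mulmxA.
by rewrite !det_mulmx det_tr; ring.
Qed.

End Evaluation.

(** A zero here would annihilate the Gram determinant at [m = 0], which is 1 by [Hdet_base]. *)
Lemma Bdet_neq0 n : Bdet n n != 0.
Proof.
have [a Ha] := Hdet_Dpol (leqnn n).
have := Ha 0%N; rewrite addn0 Hdet_base // Dpol_eval //.
by apply: contra_eq_neq => ->; rewrite expr0n mulr0 mul0r mulr0 oner_eq0.
Qed.

(** Both sides of [Dpol_shift] are evaluated by the case [k = n] of [Dpol_eval]; the nonzero factor
    [Bdet n n ^+ 2] cancels. *)
Lemma Ldet_step n m :
  Ldet n (n + m).+1 * tprod n (m%:R - 1) ^+ 2 = Ldet n (n + m) * tprod n m%:R ^+ 2.
Proof.
have := Dpol_shift n (n + m).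
have -> : (n + m)%:R / 2 = (m%:R - 1 + n%:R + 1) / 2 :> rat by rewrite natrD; congr (_ / 2); ring.
have -> : ((n + m)%:R + 1) / 2 = (m%:R + n%:R + 1) / 2 :> rat.
  by rewrite natrD; congr (_ / 2); ring.
rewrite !Dpol_eval ?leq_addr ?(leqW (leq_addr _ _)) //.
have nzB : Bdet n n ^+ 2 != 0 by rewrite expf_neq0 // Bdet_neq0.
by move=> h; apply: (mulIf nzB); rewrite mulrAC h; ring.
Qed.

Lemma Ldet_eval n m :
  Ldet n (n + m) = Ldet n n * (tprod n (m%:R - 1) / tprod n (- 1)) ^+ 2.
Proof.
have nz (x : nat) : tprod n (x%:R - 1) != 0.
  by apply: tprod_neq0; rewrite ltrBrDr (lt_le_trans _ (ler0n _ _)).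
have nz0 : tprod n (- 1) != 0 by have := nz 0%N; rewrite sub0r.
elim: m => [|m IH]; first by rewrite addn0 sub0r divff // expr1n mulr1.
have nzm : tprod n (m%:R - 1) ^+ 2 != 0 by rewrite expf_neq0.
apply: (mulIf nzm); rewrite addnS Ldet_step IH -natr1 addrK.
by field; rewrite ?nz0 ?nz.
Qed.

Theorem Hdet_eval n k m : (k <= n)%N ->
  Hdet n k (n + m) =
  ((tprod n (m%:R - 1) / tprod n (- 1)) * (tprod k m%:R / tprod k 0)) ^+ 2.
Proof.
move=> le_kn; have [a Ha] := Hdet_Dpol le_kn.
(* The case [m = 0], where [Hdet] is 1, fixes the product of all constants independent of [m]. *)
have e1 := Ha 0%N; rewrite addn0 Hdet_base // Dpol_eval // in e1.
rewrite Ha Dpol_eval ?(leq_trans le_kn (leq_addr _ _)) // Ldet_eval.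
have nz0 : tprod n (- 1) != 0 by apply: tprod_neq0.
have nzk : tprod k 0 != 0 by apply: tprod_neq0.
transitivity (a * (Ldet n n * Bdet n k ^+ 2 * tprod k 0%:R ^+ 2) *
  ((tprod n (m%:R - 1) / tprod n (- 1)) * (tprod k m%:R / tprod k 0)) ^+ 2).
  by field; apply/andP; split.
by rewrite -e1 mul1r.
Qed.

Lemma prod_pairs (k : nat) (g : nat -> rat) :
  \prod_(1 <= i < k.+1) \prod_(i <= j < k.+1) g (i + j)%N =
  \prod_(p in pairs k) g (p.1 + p.2).+2.
Proof.
rewrite big_add1 /= big_mkord.
rewrite [RHS](eq_bigl (fun p : 'I_k * 'I_k => (p.1 <= p.2)%N)) => [|p]; last by rewrite inE.
rewrite -(pair_big_dep xpredT (fun i j : 'I_k => (i <= j)%N) (fun i j => g (i + j).+2)) /=.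
apply: eq_bigr => i _; rewrite big_add1 /= big_geq_mkord /=.
by apply: eq_big => [j|j _]; rewrite ?addSn ?addnS.
Qed.

Theorem theorem4p1 (m n k : nat) (hkn : (k <= n)%N) :
  M (weightA (lam_nk n k)) (regionA m (lam_nk n k)) =
  1 / 2 ^+ n *
  ((\prod_(1 <= i < n.+1) \prod_(i <= j < n.+1)
      (((m + i + j)%:R - 1) / ((i + j)%:R - 1))) *
   (\prod_(1 <= i < k.+1) \prod_(i <= j < k.+1)
      ((m + i + j)%:R / (i + j)%:R))) ^+ 2 :> rat.
Proof.
rewrite (M_regionA m hkn) (Hdet_gcol n k (n + m)) (Hdet_eval m hkn) expr_div_n expr1n; congr (_ * (_ * _) ^+ 2).
  (* The factors 1/2 of [tprod] are kept in numerator and denominator until they cancel factor by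
     factor. *)
  transitivity (\prod_(1 <= i < n.+1) \prod_(i <= j < n.+1)
     (((m%:R - 1 + (i + j)%:R) / 2) / ((-1 + (i + j)%:R) / 2)) : rat).
    rewrite (prod_pairs n (fun u => ((m%:R - 1 + u%:R) / 2) / ((-1 + u%:R) / 2))).
    by rewrite prodf_div.
  apply: eq_bigr => i _; apply: eq_bigr => j _.
  by rewrite -mulf_div divff // mulr1 -addnA natrD; congr (_ / _); ring.
transitivity (\prod_(1 <= i < k.+1) \prod_(i <= j < k.+1)
     (((m%:R + (i + j)%:R) / 2) / ((0 + (i + j)%:R) / 2)) : rat).
  rewrite (prod_pairs k (fun u => ((m%:R + u%:R) / 2) / ((0 + u%:R) / 2))).
  by rewrite prodf_div.
apply: eq_bigr => i _; apply: eq_bigr => j _.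
by rewrite -mulf_div divff // mulr1 -addnA add0r [(m + _)%:R]natrD.
Qed.
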